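(* $H_{\mathrm{even}}\cap(20000,25000]$ is contained in the twenty-seven-element candidate set \[ \begin{aligned} \{ & 20138, 20338, 20506, 20662, 20926, 20974, 21118, 21302,\\ & 21334, 21466, 21818, 21958, 22054, 22234, 22262, 22394, 22486,\\ & 22642, 22706, 23194, 23402, 23578, 23878, 23942, 24082, 24298,\\ & 24914 \}. \end{aligned} \]
   Context: 3-Higgs primes are defined recursively: $2$ is 3-Higgs; an odd prime $p$ is 3-Higgs if and only if every prime factor $q$ of $p-1$ is a 3-Higgs prime (necessarily $q<p$) and satisfies $v_q(p-1)\le 3$ (including $v_2(p-1)\le 3$), where $v_q$ is the $q$-adic valuation. $H$ is the set of integers $m\ge 1$ such that every prime factor of $2^m+1$ is 3-Higgs, and $H_{\mathrm{even}}=H\cap 2\mathbb{Z}$. *)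

(* Defs.v *)
From mathcomp Require Import all_boot.

Set Implicit Arguments.
Unset Strict Implicit.
Unset Printing Implicit Defensive.

(* Least-fixed-point reading of the recursion; it is well founded because a
   prime factor of p.-1 is smaller than p. *)
Inductive higgs3 : nat -> Prop :=
| Higgs3_two : higgs3 2
| Higgs3_odd (p : nat) : prime p -> odd p ->
    (forall q : nat, prime q -> q %| p.-1 -> higgs3 q) ->
    (forall q : nat, prime q -> q %| p.-1 -> logn q p.-1 <= 3) ->
    higgs3 p.

Lemma higgs3_oddE (p : nat) : prime p -> odd p ->
  higgs3 p <->
  (forall q : nat, prime q -> q %| p.-1 -> higgs3 q /\ logn q p.-1 <= 3).
Proof.
move=> p_pr p_odd; split=> [p_higgs | p1].
  by case: p_higgs p_odd => // {p_pr}p _ _ hq vq _ q q_pr qp; split; auto.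
by apply: Higgs3_odd => // q q_pr /(p1 q q_pr)[].
Qed.

Definition H (m : nat) : Prop :=
  1 <= m /\ forall p : nat, prime p -> p %| 2 ^ m + 1 -> higgs3 p.

Definition Heven (m : nat) : Prop := H m /\ ~~ odd m.

Definition candidates : seq nat :=
  [:: 20138; 20338; 20506; 20662; 20926; 20974; 21118; 21302;
      21334; 21466; 21818; 21958; 22054; 22234; 22262; 22394; 22486;
      22642; 22706; 23194; 23402; 23578; 23878; 23942; 24082; 24298;
      24914].

(* Main.v *)
From Stdlib Require Import NArith.
Require Import Defs.
From mathcomp Require Import all_boot.
From mathcomp Require Import zify.

(** The set [H] is closed under division by odd numbers, because
    [2 ^ d + 1] divides [2 ^ (d * c) + 1] when [c] is odd.  To exclude an even
    [m], it is therefore enough to find a prime that is not 3-Higgs and that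
    divides [2 ^ d + 1] for some divisor [d] of [m] with [m / d] odd.

    If [4] divides [m], then every prime factor [p] of [2 ^ m + 1] will do.
    Such a [p] is [1] modulo [8], so [2] has a square root [y] modulo [p]; as
    [y ^ (2 * m) = 2 ^ m = -1], the order of [y] is divisible by [16], hence so
    is [p - 1] ([dvdn16_pred]).

    There remain the numbers [m = 2 * k] with [k] odd.  If a prime factor [q] of
    [k] is not 3-Higgs, then [2 ^ (2 * q) + 1] has a prime factor other than
    [5]; modulo such a prime [4] has order [2 * q], so the prime is [1] modulo
    [q] and is not 3-Higgs either ([excluded_prime]).  For nearly all other
    [k], apart from the twenty-seven candidates, the tables give an explicit
    prime factor of [2 ^ (2 * d) + 1] for a divisor [d] of [k].  These factors
    were found by trial division, by the [p - 1] method and with elliptic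
    curves.

    For [k = 10141] and [k = 10511 = 23 * 457] the witness is of another kind.
    When [d] is [10141] or [457], one of the two Aurifeuillian factors
    [2 ^ d +- 2 ^ ((d + 1) / 2) + 1] of [2 ^ (2 * d) + 1] happens to be prime.
    It has 10142 bits in the first case, too many for a primality proof by
    computation.  But a number [c] with [c ^ 4 = 2] modulo that factor is a
    short certificate: modulo each prime [p] dividing the factor, the order of
    [c] is divisible by [16], so [16] divides [p - 1] ([excluded_quartic]).

    The table [non_higgs_primes] lists primes, each with the reason why it is
    not 3-Higgs: [p - 1] is divisible by an earlier prime of the list, or by a
    fourth power.  The table [exclusions] pairs a number [d] with a prime of
    that list, which is [d] itself or a factor of [2 ^ (2 * d) + 1].  The primes
    reach 89 bits, so their primality rests on Pocklington's method
    ([order_checkP]): if a number has an order divisible by [f] modulo every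
    prime factor of [n], then these factors are [1] modulo [f], which leaves few
    possible divisors of [n] below its square root. *)

Set Implicit Arguments.
Unset Strict Implicit.
Unset Printing Implicit Defensive.

(** * Orders modulo a prime *)

Lemma expn_gcd_eq1 a m n p : 0 < m ->
  a ^ m = 1 %[mod p] -> a ^ n = 1 %[mod p] -> a ^ gcdn m n = 1 %[mod p].
Proof.
move=> m_gt0 am an; have [u v def_um _] := egcdnP n m_gt0.
have pow1 b c : a ^ b = 1 %[mod p] -> a ^ (c * b) = 1 %[mod p].
  by move=> ab; rewrite mulnC expnM -modnXm ab modnXm exp1n.
have := pow1 m u am; rewrite def_um expnD -modnMml (pow1 _ _ an) modnMml.
by rewrite mul1n.
Qed.

Lemma fermat_eq1 a m p : prime p -> 0 < m -> a ^ m = 1 %[mod p] ->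
  a ^ p.-1 = 1 %[mod p].
Proof.
move=> p_pr m_gt0 am; have p_gt1 := prime_gt1 p_pr.
have co_pa : coprime p a.
  rewrite prime_coprime //; apply/negP=> p_a.
  have: p %| a ^ m by rewrite Euclid_dvdX // p_a.
  by rewrite /dvdn am modn_small.
have := fermat_little a p_pr; rewrite -{1}(prednK (prime_gt0 p_pr)) expnS.
have a_gt0 : 0 < a.
  case: (posnP a) co_pa => // ->.
  by rewrite /coprime gcdn0 => /eqP p1; rewrite p1 in p_gt1.
have ap_gt0 : 0 < a ^ p.-1 by rewrite expn_gt0 a_gt0.
move/eqP; rewrite eqn_mod_dvd ?leq_pmulr // -[X in _ - X]muln1 -mulnBr.
by rewrite Gauss_dvdr // -eqn_mod_dvd // => /eqP.
Qed.

(** If [a ^ m] is [1] but [a ^ (m %/ r)] is not, then the order of [a] contains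
    the full power of [r] that is in [m]. *)
Lemma prime_power_dvd_pred a m r e p : prime p -> prime r -> 0 < m ->
  r ^ e %| m -> a ^ m = 1 %[mod p] -> a ^ (m %/ r) <> 1 %[mod p] ->
  r ^ e %| p.-1.
Proof.
move=> p_pr r_pr m_gt0 re_m am am'.
have p1_gt0 : 0 < p.-1 by rewrite -ltnS prednK ?prime_gt0 ?prime_gt1.
rewrite pfactor_dvdn // leqNgt; apply/negP=> lt_e; apply: am'.
have ag := expn_gcd_eq1 m_gt0 am (fermat_eq1 p_pr m_gt0 am).
have g_gt0 : 0 < gcdn m p.-1 by rewrite gcdn_gt0 m_gt0.
have /dvdnP[h def_m] := dvdn_gcdl m p.-1.
have h_gt0 : 0 < h by move: m_gt0; rewrite def_m; case: (h).
have: 0 < logn r h.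
  have := dvdn_leq_log r p1_gt0 (dvdn_gcdr m p.-1).
  move: re_m; rewrite pfactor_dvdn // {1}def_m lognM //; lia.
rewrite logn_gt0 mem_primes => /and3P[_ _ /dvdnP[c def_h]].
have -> : m %/ r = gcdn m p.-1 * c.
  by rewrite [in LHS]def_m def_h mulnAC mulnK ?prime_gt0 // mulnC.
by rewrite expnM -modnXm ag modnXm exp1n.
Qed.

Lemma expn_eq1_of_eqN1 a m p : 0 < a -> p %| a ^ m + 1 ->
  a ^ (m * 2) = 1 %[mod p].
Proof.
move=> a_gt0 p_am; apply/eqP; rewrite eqn_mod_dvd ?expn_gt0 ?a_gt0 //.
by rewrite expnM -[X in _ - X](exp1n 2) subn_sqr dvdn_mull.
Qed.

Lemma expn_neq1_of_eqN1 a m p : 2 < p -> p %| a ^ m + 1 ->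
  a ^ m <> 1 %[mod p].
Proof.
move=> p_gt2 p_am am1; have: 2 = 0 %[mod p].
  by rewrite -[2]/(1 + 1) -modnDml -am1 modnDml mod0n; apply/eqP.
by rewrite mod0n modn_small.
Qed.

Lemma dvdn_expnD1 a d c : odd c -> a ^ d + 1 %| a ^ (d * c) + 1.
Proof.
move=> c_odd; rewrite expnM; move: (a ^ d) => x.
have [->|x_gt0] := posnP x; first by rewrite add0n dvd1n.
rewrite -(odd_double_half c) c_odd add1n -muln2.
elim: (c./2) => [|n IHn]; first by rewrite mul0n expn1.
have x1 : x + 1 %| x ^ 2 - 1 by rewrite -(exp1n 2) subn_sqr dvdn_mull ?exp1n.
rewrite -(dvdn_addl _ x1) mulSn add2n -addn2 expnD.
suff -> : x ^ (n * 2).+1 * x ^ 2 + 1 + (x ^ 2 - 1)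
          = (x ^ (n * 2).+1 + 1) * x ^ 2 by rewrite dvdn_mulr.
have := expn_gt0 x 2; rewrite x_gt0 /=; nia.
Qed.

Lemma prime_gt2_dvd_expnD1 m p : 0 < m -> prime p -> p %| 2 ^ m + 1 -> 2 < p.
Proof.
move=> m_gt0 p_pr p_m; rewrite ltn_neqAle prime_gt1 // andbT.
by apply: contraTneq p_m => <-; rewrite dvdn2 oddD oddX /= orbF gtn_eqF.
Qed.

(** A [j]-th root of [2] raised to the power [j * m] is [-1] modulo [p], so the
    full power of [2] in [2 * j * m] divides its order. *)
Lemma root2_dvd_pred c j m e p : 0 < j -> 0 < m -> prime p ->
    p %| 2 ^ m + 1 -> c ^ j = 2 %[mod p] -> 2 ^ e %| j * m * 2 ->
  2 ^ e %| p.-1.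
Proof.
move=> j_gt0 m_gt0 p_pr p_m cj e_jm.
have p_gt2 := prime_gt2_dvd_expnD1 m_gt0 p_pr p_m.
have cjm : p %| c ^ (j * m) + 1.
  by rewrite /dvdn -modnDml expnM -modnXm cj modnXm modnDml.
have c_gt0 : 0 < c.
  case: (posnP c) cj => // ->; rewrite exp0n // mod0n modn_small //.
apply: (@prime_power_dvd_pred c (j * m * 2)) => //.
- by rewrite !muln_gt0 j_gt0 m_gt0.
- exact: expn_eq1_of_eqN1.
by rewrite mulnK //; apply: expn_neq1_of_eqN1.
Qed.

(** A square root of [2] modulo [p] is [z + z ^ -1], where [z = 2 ^ (m %/ 4)] is
    a primitive eighth root of unity; its inverse is written [z ^ 7]. *)
Lemma dvdn16_pred m p : 0 < m -> 4 %| m -> prime p -> p %| 2 ^ m + 1 ->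
  16 %| p.-1.
Proof.
move=> m_gt0 m4 p_pr p_m; have p_gt2 := prime_gt2_dvd_expnD1 m_gt0 p_pr p_m.
have z_gt0 : 0 < 2 ^ (m %/ 4) by rewrite expn_gt0.
have def_m : m = m %/ 4 * 4 by rewrite divnK.
pose z := 2 ^ (m %/ 4); pose y := z + z ^ 7.
have z4 : p %| z ^ 4 + 1 by rewrite -expnM -def_m.
have y2 : y ^ 2 = 2 %[mod p].
  have [c def_c] := dvdnP z4.
  have: y ^ 2 + c * z ^ 6 * p
        = c * (z ^ 2 * (z ^ 8 + 1) + 2 * (z ^ 4 - 1)) * p + 2.
    have -> : z ^ 6 = z ^ 4 * z ^ 2 by rewrite -expnD.
    have -> : z ^ 8 = z ^ 4 * z ^ 4 by rewrite -expnD.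
    have -> : y ^ 2 = z ^ 2 + 2 * (z ^ 4 * z ^ 4)
                      + z ^ 4 * z ^ 4 * z ^ 4 * z ^ 2.
      by rewrite -!expnD sqrnD -expnM -expnS addnAC.
    have cp n : c * n * p = (z ^ 4 + 1) * n by rewrite def_c mulnAC.
    rewrite !cp.
    have := expn_gt0 z 4; rewrite z_gt0 /=.
    by case: (z ^ 4) => // w _; rewrite subn1 /=; nia.
  by move/(congr1 (modn^~ p)); rewrite addnC !modnMDl.
apply: (@root2_dvd_pred y 2 m 4) => //.
by rewrite mulnAC -[2 ^ 4]/(4 * 4) dvdn_mul.
Qed.

(** * Primes that are not 3-Higgs *)

Lemma not_higgs3_factor p q : q %| p.-1 -> prime q -> ~ higgs3 q -> 2 < p ->
  ~ higgs3 p.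
Proof.
move=> q_p q_pr q_nh p_gt2 p_h; case: p_h q_p p_gt2 => // {}p _ _ p_h _ q_p _.
exact: q_nh (p_h q q_pr q_p).
Qed.

Lemma not_higgs3_pow4 p q : prime q -> q ^ 4 %| p.-1 -> 2 < p -> ~ higgs3 p.
Proof.
move=> q_pr q4_p p_gt2 p_h; case: p_h q4_p p_gt2 => // {}p p_pr _ _ p_v q4_p _.
have p1_gt0 : 0 < p.-1 by rewrite -ltnS prednK ?prime_gt0 ?prime_gt1.
have q_p : q %| p.-1 by apply: dvdn_trans q4_p; rewrite dvdn_exp.
by have := p_v q q_pr q_p; rewrite leqNgt -pfactor_dvdn // q4_p.
Qed.

Lemma higgs3_5 : higgs3 5.
Proof.
apply: Higgs3_odd => // q q_pr;
  rewrite (@Euclid_dvdX 2 2) //= andbT dvdn_prime2 // => /eqP-> //.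
exact: Higgs3_two.
Qed.

(** * Even numbers outside of H *)

(** The parameter is [d] and not [2 * d], because an odd multiple of [2 * d] is
    the double of any odd multiple of [d]. *)
Definition excluded d :=
  exists p, [/\ prime p, p %| 2 ^ (2 * d) + 1 & ~ higgs3 p].

Lemma excluded_not_H d c : odd c -> excluded d -> ~ H (2 * (d * c)).
Proof.
move=> c_odd [p [p_pr p_d p_nh]] [_ Hm]; apply: p_nh; apply: Hm => //.
by apply: dvdn_trans p_d _; rewrite mulnA dvdn_expnD1.
Qed.

Lemma not_H_dvd4 m : 4 %| m -> ~ H m.
Proof.
move=> m4 [m_gt0 Hm]; set p := pdiv (2 ^ m + 1).
have p_pr : prime p by rewrite pdiv_prime // addn1 ltnS expn_gt0.
have p_m : p %| 2 ^ m + 1 by apply: pdiv_dvd.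
apply: (@not_higgs3_pow4 p 2) (Hm p p_pr p_m) => //.
  exact: dvdn16_pred m_gt0 m4 p_pr p_m.
exact: prime_gt2_dvd_expnD1 m_gt0 p_pr p_m.
Qed.

(** Since [4 ^ q + 1 = (5 - 1) ^ q + 1] is [5 * q] modulo [25], the cofactor of
    [5] in it is prime to [5].  A prime factor [p] of the cofactor does not
    divide [4 ^ 2 - 1 = 3 * 5], so [4] has order [2 * q] modulo [p]. *)
Lemma excluded_prime q : prime q -> odd q -> ~ higgs3 q -> excluded q.
Proof.
move=> q_pr q_odd q_nh.
have q_neq5 : q != 5.
  by apply/eqP=> q5; apply: q_nh; rewrite q5; apply: higgs3_5.
have def_q : q = (q./2 * 2).+1 by rewrite -[LHS]odd_double_half q_odd muln2.
have mod25 n : 4 ^ (n * 2).+1 + 1 = 5 * (n * 2).+1 %[mod 25].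
  elim: n => // n IHn; apply/eqP; rewrite -(eqn_modDr 15).
  have -> : 4 ^ (n.+1 * 2).+1 + 1 + 15 = 16 * (4 ^ (n * 2).+1 + 1).
    by rewrite mulSn !expnS; lia.
  rewrite -modnMmr IHn modnMmr.
  have -> : 16 * (5 * (n * 2).+1) = (6 * n + 2) * 25 + (5 * (n.+1 * 2).+1 + 15).
    lia.
  by rewrite modnMDl.
have /dvdnP[S def_S] : 4 ^ 1 + 1 %| 4 ^ q + 1 by rewrite -[q]mul1n dvdn_expnD1.
have S5 : ~~ (5 %| S).
  apply: contra q_neq5 => S5.
  have: 5 * 5 %| 4 ^ q + 1 by rewrite def_S dvdn_mul.
  have := mod25 q./2; rewrite -def_q /dvdn => -> /=.
  by rewrite -/(5 * 5 %| 5 * q) dvdn_pmul2l // dvdn_prime2 // eq_sym.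
have S_gt1 : 1 < S.
  have: 4 ^ 2 < 4 ^ q + 1.
    by rewrite addn1 ltnS leq_exp2l // prime_gt1.
  by rewrite def_S; lia.
set p := pdiv S; have p_pr : prime p by apply: pdiv_prime.
have p_S : p %| 4 ^ q + 1 by rewrite def_S dvdn_mulr // pdiv_dvd.
have p_neq5 : p != 5 by apply: contraNneq S5 => p5; rewrite -p5 pdiv_dvd.
have p_S2 : p %| 2 ^ (2 * q) + 1 by rewrite expnM.
exists p; split=> //; have p_gt2 : 2 < p.
  apply: (prime_gt2_dvd_expnD1 _ p_pr p_S2).
  by rewrite muln_gt0 (prime_gt0 q_pr).
apply: (not_higgs3_factor _ q_pr q_nh p_gt2).
rewrite -[q]expn1; apply: (@prime_power_dvd_pred 4 (q * 2)) => //.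
- by rewrite muln_gt0 (prime_gt0 q_pr).
- by rewrite expn1 dvdn_mulr.
- exact: expn_eq1_of_eqN1.
rewrite mulKn ?prime_gt0 // => /eqP; rewrite eqn_mod_dvd //=.
rewrite -[4 ^ 2 - 1]/(3 * 5) Euclid_dvdM // !dvdn_prime2 // (negPf p_neq5) orbF.
move/eqP=> p3; move: p_S; rewrite p3.
by rewrite /dvdn -modnDml -modnXm exp1n.
Qed.

(** The factorization of [x ^ 4 + 4 * y ^ 4] with [x = 1] and [4 * y ^ 4 =
    2 ^ (2 * k)]. *)
Lemma aurifeuille k : odd k -> let h := k.+1./2 in
  (2 ^ k - 2 ^ h + 1) * (2 ^ k + 2 ^ h + 1) = 2 ^ (2 * k) + 1.
Proof.
move=> k_odd h; have def_k : k.+1 = (h * 2).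
  by rewrite muln2 -[LHS]odd_double_half /= k_odd.
have le_h : h <= k by lia.
have le2 : 2 ^ h <= 2 ^ k by rewrite leq_pexp2l.
have x2 : 2 ^ h * 2 ^ h = 2 * 2 ^ k by rewrite -expnD addnn -muln2 -def_k expnS.
rewrite mul2n -addnn expnD; nia.
Qed.

(** The argument applies to every prime factor of [n].  In practice [c] can be
    found when [n] is prime, by extracting square roots. *)
Lemma excluded_quartic k n c : 0 < k -> 1 < n -> n %| 2 ^ (2 * k) + 1 ->
  c ^ 4 = 2 %[mod n] -> excluded k.
Proof.
move=> k_gt0 n_gt1 n_k c4; have p_pr := pdiv_prime n_gt1.
have p_k : pdiv n %| 2 ^ (2 * k) + 1 := dvdn_trans (pdiv_dvd n) n_k.
have k2_gt0 : 0 < 2 * k by rewrite muln_gt0.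
exists (pdiv n); split=> //.
apply: (@not_higgs3_pow4 _ 2) => //; last exact: prime_gt2_dvd_expnD1 p_k.
apply: (@root2_dvd_pred c 4 (2 * k)) => //.
  by rewrite -(modn_dvdm _ (pdiv_dvd n)) c4 modn_dvdm ?pdiv_dvd.
by rewrite -mulnA [2 * k * 2]mulnAC mulnA dvdn_mulr.
Qed.

(** * Arithmetic of binary numbers *)

Lemma nat_of_add (a b : N) : (a + b)%num = a + b :> nat.
Proof. lia. Qed.

Lemma nat_of_sub (a b : N) : (a - b)%num = a - b :> nat.
Proof. lia. Qed.

Lemma nat_of_mul (a b : N) : (a * b)%num = a * b :> nat.
Proof. lia. Qed.

Lemma nat_of_mod (a b : N) : (a mod b)%num = a %% b :> nat.
Proof.
have [->|b_neq0] := eqVneq b 0%num; first by rewrite N.mod_0_r modn0.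
have := congr1 nat_of_bin (N.div_mod a b (elimN eqP b_neq0)).
rewrite nat_of_add nat_of_mul mulnC => def_a; rewrite [in RHS]def_a.
by rewrite modnMDl modn_small //; have := N.mod_lt a b (elimN eqP b_neq0); lia.
Qed.

Definition dvdN (d n : N) : bool := (n mod d =? 0)%num.

Lemma dvdNE (d n : N) : dvdN d n = (d %| n).
Proof. by rewrite /dvdN /dvdn -nat_of_mod; lia. Qed.

Lemma nat_of_exp (a b : N) : (a ^ b)%num = a ^ b :> nat.
Proof.
elim/N.peano_ind: b => [//|b IHb].
by rewrite N.pow_succ_r' nat_of_mul IHb -expnS; congr (_ ^ _); lia.
Qed.

Lemma nat_of_div (a b : N) : (a / b)%num = a %/ b :> nat.
Proof.
have [->|b_neq0] := eqVneq b 0%num; first by rewrite N.div_0_r.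
have b_gt0 : 0 < b.
  by rewrite lt0n; apply: contraNneq b_neq0; case: (b) => // p; lia.
have := congr1 nat_of_bin (N.div_mod a b (elimN eqP b_neq0)).
rewrite nat_of_add nat_of_mul mulnC nat_of_mod // => def_a.
by rewrite [in RHS]def_a divnMDl // divn_small ?addn0 ?ltn_mod.
Qed.

Lemma dvdn_gcdN p (a b : N) : p %| a -> p %| b -> p %| N.gcd a b.
Proof.
have toN (c : N) : p %| c -> N.divide (bin_of_nat p) c.
  case/dvdnP=> d def_c; exists (bin_of_nat d).
  by apply: (can_inj nat_of_binK); rewrite nat_of_mul !bin_of_natK.
move=> /toN pa /toN pb; have [c ->] := N.gcd_greatest _ _ _ pa pb.
by rewrite nat_of_mul bin_of_natK dvdn_mull.
Qed.

Fixpoint powmod_pos (n a : N) (e : positive) : N :=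
  match e with
  | xH => (a mod n)%num
  | xO e' => let b := powmod_pos n a e' in ((b * b) mod n)%num
  | xI e' => let b := powmod_pos n a e' in ((b * b) mod n * a mod n)%num
  end.

Definition powmod (n a e : N) : N :=
  if e is Npos e' then powmod_pos n a e' else (1 mod n)%num.

Lemma powmodE (n a e : N) : 0 < n -> powmod n a e = a ^ e %% n :> nat.
Proof.
move=> n_gt0; case: e => [|e]; first by rewrite nat_of_mod.
rewrite /=; elim: e => [e IHe|e IHe|] /=; last by rewrite expn1 nat_of_mod.
  rewrite NatTrec.doubleE !(nat_of_mul, nat_of_mod) // IHe modnMm -addnn.
  by rewrite modnMml -expnD expnSr.
by rewrite NatTrec.doubleE !(nat_of_mul, nat_of_mod) // IHe modnMm -addnn expnD.
Qed.

Fixpoint no_dvdN (n s : N) (t : nat) (d : N) : bool :=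
  if t is t'.+1 then
    let d' := (d + s)%num in ~~ dvdN d' n && no_dvdN n s t' d'
  else true.

Lemma no_dvdNP (n s : N) t (d : N) i : 0 < s -> no_dvdN n s t d ->
  0 < i <= t -> ~~ (d + i * s %| n).
Proof.
move=> s_gt0; elim: t d i => [|t IHt] d i; first by case: i.
rewrite /=; set d' := (d + s)%num => /andP[nd1 nd].
have def_d' : d' = d + s :> nat by rewrite nat_of_add.
case: i => [|[|i]] //= i_le; last first.
  by rewrite mulSn addnA -def_d'; apply: IHt.
by rewrite mul1n -def_d' -dvdNE // def_d' addn_gt0 s_gt0 orbT.
Qed.

(** * Certified primality *)

(** The least prime factor of a composite [n] would be at most the square root
    of [n], and of the form [1 + i * f]. *)
Lemma prime_of_divisors n f t : 1 < n -> 0 < f ->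
    (forall p, prime p -> p %| n -> p = 1 %[mod f]) ->
    (forall i, 0 < i <= t -> ~~ (1 + i * f %| n)) ->
    n < (1 + t.+1 * f) ^ 2 -> prime n.
Proof.
move=> n_gt1 f_gt0 n1 nd lt_n; apply: ltn_pdiv2_prime; first exact: ltnW.
apply: leq_trans lt_n _; rewrite leq_sqr leqNgt; apply/negP=> lt_p.
have p_pr := pdiv_prime n_gt1; have p_n := pdiv_dvd n.
have /eqP := n1 _ p_pr p_n.
rewrite eqn_mod_dvd ?prime_gt0 // => /dvdnP[i def_i].
have def_p : pdiv n = 1 + i * f by rewrite -def_i subnKC ?prime_gt0.
have := nd i; rewrite -def_p p_n => /(_ _)/negP[] //.
case: i def_p {def_i} => [|i] def_p; first by rewrite def_p in p_pr.
by move: lt_p; rewrite def_p !add1n ltnS ltn_mul2r f_gt0.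
Qed.

(** The number of trials comes from [N.sqrt], and the final multiplication
    confirms that they reach the square root of [n]. *)
Definition no_small_divisor (n f : N) : bool :=
  let t := (N.sqrt n / f)%num in
  [&& (1 <? n)%num, (0 <? f)%num, no_dvdN n f t 1
    & (n <? (1 + (t + 1) * f) * (1 + (t + 1) * f))%num].

Lemma prime_no_small_divisor (n f : N) : no_small_divisor n f ->
  (forall p, prime p -> p %| n -> p = 1 %[mod f]) -> prime n.
Proof.
rewrite /no_small_divisor; set t := (N.sqrt n / f)%num.
case/and4P=> n_gt1 f_gt0 nd lt_n n1; have {}f_gt0 : 0 < f by lia.
apply: (@prime_of_divisors n f t) => //; first by lia.
  by move=> i le_i; apply: (no_dvdNP f_gt0 nd le_i).
have -> : (1 + t.+1 * f) ^ 2 = ((1 + (t + 1) * f) * (1 + (t + 1) * f))%num.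
  by rewrite !(nat_of_mul, nat_of_add) addn1.
lia.
Qed.

Definition trial_prime (n : N) : bool :=
  (n =? 2)%num || ~~ dvdN 2 n && no_small_divisor n 2.

Lemma trial_primeP (n : N) : trial_prime n -> prime n.
Proof.
case/orP=> [/N.eqb_eq->//|/andP[n_odd /prime_no_small_divisor]]; apply.
move=> p p_pr p_n; rewrite dvdNE // dvdn2 negbK in n_odd.
by rewrite !modn2 (dvdn_odd p_n n_odd).
Qed.

Definition factored (rs : seq (N * N)) : N :=
  foldr (fun re f => re.1 ^ re.2 * f)%num 1%num rs.

(** In the gcd, [n - 1] stands for [-1]: the test is that [a ^ (m / r)] differs
    from [1] modulo every prime factor of [n].  The list [ps] holds primes that
    are already certified and may be too large for trial division. *)
Definition order_check (ps : seq N) (n a m : N) (rs : seq (N * N)) : bool :=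
  [&& (1 <? n)%num, (0 <? m)%num, (powmod n a m =? 1)%num,
      dvdN (factored rs) m
    & all (fun re => (if re.1 \in ps then true else trial_prime re.1) &&
        (N.gcd (powmod n a (m / re.1) + (n - 1)) n =? 1)%num) rs].

(** Pocklington's criterion: each prime power in [rs] divides the order of [a]
    modulo [p], hence divides [p.-1]. *)
Lemma order_checkP ps (n a m : N) rs p : order_check ps n a m rs ->
    (forall r : N, r \in ps -> prime r) ->
  prime p -> p %| n -> p = 1 %[mod factored rs].
Proof.
case/and5P=> n_gt1 m_gt0 /N.eqb_eq am1 f_m /allP rsP psP p_pr p_n.
have rs_pr re : re \in rs -> prime re.1.
  by case/rsP/andP; case: ifP => [/psP //|_ /trial_primeP].
have {}n_gt1 : 1 < n by lia.
have {}m_gt0 : 0 < m by lia.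
have f_gt0 : 0 < factored rs.
  elim: rs rs_pr {f_m rsP} => //= re rs IHrs rs_pr.
  rewrite nat_of_mul nat_of_exp muln_gt0 expn_gt0 IHrs ?andbT => [|x rs_x].
    by rewrite prime_gt0 // rs_pr ?mem_head.
  by apply: rs_pr; rewrite inE rs_x orbT.
rewrite dvdNE // in f_m.
have prime_mod x y : x = y %[mod n] -> x = y %[mod p].
  by move=> xy; rewrite -(modn_dvdm x p_n) xy modn_dvdm.
apply/eqP; rewrite eqn_mod_dvd ?prime_gt0 // subn1; apply/dvdn_partP=> // r.
rewrite mem_primes => /and3P[r_pr _ r_f].
have [e rs_r] : exists e, (bin_of_nat r, e) \in rs.
  elim: rs rs_pr r_f {f_m f_gt0 rsP} => [_|[r' e] rs IHrs rs_pr /=].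
    by rewrite dvdn1 => /eqP r1; rewrite r1 in r_pr.
  rewrite nat_of_mul nat_of_exp Euclid_dvdM // => /orP[r_r'|r_rs].
    have r'_pr : prime r' := rs_pr _ (mem_head _ _).
    exists e; move: r_r'; rewrite Euclid_dvdX // => /andP[].
    by rewrite dvdn_prime2 // => /eqP-> _; rewrite nat_of_binK mem_head.
  have [x rs_x|e' rs_e'] := IHrs _ r_rs.
    by rewrite rs_pr // inE rs_x orbT.
  by exists e'; rewrite inE rs_e' orbT.
have /andP[_ /N.eqb_eq gcd1] := rsP _ rs_r.
rewrite /= in gcd1.
rewrite p_part; apply: (@prime_power_dvd_pred a m) => //.
- by apply: dvdn_trans f_m; rewrite -p_part dvdn_part.
- by apply: prime_mod; rewrite -powmodE ?am1 ?modn_small // ltnW.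
move=> amr; have: p %| 1%num; last by rewrite dvdn1; case: (p) p_pr => [|[]].
rewrite -gcd1; apply: dvdn_gcdN => //.
rewrite nat_of_add powmodE; last exact: ltnW.
rewrite nat_of_div ?bin_of_natK ?prime_gt0 //.
rewrite (_ : (n - 1)%num = n - 1 :> nat); last by lia.
by rewrite /dvdn -modnDml modn_dvdm // amr modnDml subnKC // ltnW.
Qed.

(** The arguments of [Order] are those of [order_check].  In the table, [m] is
    often a factored divisor of the number minus [1], about as large as its
    square root, and [a] has order [m]: this keeps the exponents short. *)
Inductive primality_witness := Trial
  | Order of N & N & seq (N * N).

Definition prime_check (ps : seq N) (n : N) (w : primality_witness) : bool :=
  match w with
  | Trial => trial_prime n
  | Order a m rs => order_check ps n a m rs && no_small_divisor n (factored rs)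
  end.

Lemma prime_checkP ps (n : N) w : prime_check ps n w ->
  (forall r : N, r \in ps -> prime r) -> prime n.
Proof.
case: w => [/trial_primeP//|a m rs /andP[ord /prime_no_small_divisor]] n1 psP.
by apply: n1 => p; apply: order_checkP ord psP.
Qed.

(** * Checking the tables *)

(** A prime [p], a prime [q] such that [p - 1] is a multiple of [q] or of
    [q ^ 4], and a certificate for [p]. *)
Definition entry := (N * N * primality_witness)%type.

(** A conditional rather than a disjunction: under call by value, a disjunction
    would run the trial division on the large primes of [known] as well. *)
Definition excluded_by (known : seq N) (p q : N) : bool :=
  if q \in known then dvdN q (p - 1)
  else trial_prime q && dvdN (q ^ 4) (p - 1).

Fixpoint non_higgs_check (known : seq N) (es : seq entry) : bool :=
  if es is (p, q, w) :: es' then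
    [&& prime_check known p w, (2 <? p)%num, excluded_by known p q
      & non_higgs_check (p :: known) es']
  else true.

Definition non_higgs_prime (p : N) : Prop := prime p /\ ~ higgs3 p.

Lemma non_higgs_checkP known es : non_higgs_check known es ->
    (forall p, p \in known -> non_higgs_prime p) ->
  forall p, p \in map (fun e : entry => e.1.1) es -> non_higgs_prime p.
Proof.
elim: es known => [|[[p q] w] es IHes] known //= /and4P[p_pr].
move=> p_gt2 q_p es_ok knownP.
have {}p_pr : prime p by apply: prime_checkP p_pr _ => r /knownP[].
have {}p_gt2 : 2 < p by lia.
have p1E : (p - 1)%num = p.-1 :> nat by lia.
have p_nh : non_higgs_prime p.
  split=> //; move: q_p; rewrite /excluded_by; case: ifP => [known_q q_p|_].
    have [q_pr q_nh] := knownP q known_q.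
    rewrite dvdNE ?prime_gt0 // p1E in q_p.
    exact: not_higgs3_factor q_p q_pr q_nh p_gt2.
  case/andP=> /trial_primeP q_pr.
  rewrite dvdNE nat_of_exp ?expn_gt0 ?prime_gt0 // p1E => q_p.
  exact: not_higgs3_pow4 q_pr q_p p_gt2.
have known'P x : x \in p :: known -> non_higgs_prime x.
  by rewrite inE => /orP[/eqP->|/knownP].
move=> x; rewrite inE => /orP[/eqP->//|]; exact: IHes es_ok known'P x.
Qed.

Definition exclusion_check (known : seq N) (dp : N * N) : bool :=
  let: (d, p) := dp in
  [&& p \in known, ~~ dvdN 2 d
    & if (d =? p)%num then true else (powmod p 2 (2 * d) =? p - 1)%num].

Lemma exclusion_checkP known dp : exclusion_check known dp ->
    (forall p, p \in known -> non_higgs_prime p) ->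
  excluded dp.1.
Proof.
case: dp => d p /and3P[known_p]; rewrite dvdNE // dvdn2 negbK => d_odd dp.
move=> /(_ p known_p)[p_pr p_nh] /=; move: dp.
case: ifP => [/N.eqb_eq def_d _|_].
  by rewrite def_d in d_odd *; apply: excluded_prime.
move=> /N.eqb_eq def_p; exists p; split=> //.
have p_gt0 := prime_gt0 p_pr.
have: powmod p 2 (2 * d) = p - 1 :> nat by rewrite def_p; lia.
rewrite powmodE // nat_of_mul => def_m.
by rewrite /dvdn -modnDml def_m subnK ?modnn.
Qed.

(** Only the odd halves [k] of even numbers matter, hence the step of [2]. *)
Fixpoint covered (cs ds : seq N) (n : nat) (k : N) : bool :=
  if n is n'.+1 then
    (((2 * k)%num \in cs) || has (fun d => dvdN d k) ds) &&
    covered cs ds n' (k + 2)%num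
  else true.

Lemma coveredP cs ds n k i : covered cs ds n k -> i < n ->
  exists2 k' : N, k' = k + 2 * i :> nat
    & (2 * k')%num \in cs \/ exists2 d, d \in ds & dvdN d k'.
Proof.
elim: n k i => // n IHn k [|i] /= /andP[k_cov n_cov] lt_i.
  exists k; first by rewrite addn0.
  by case/orP: k_cov => [|/hasP]; [left|right].
have [k' def_k' k'_cov] := IHn _ i n_cov lt_i.
by exists k' => //; rewrite def_k' nat_of_add -addnA mulnS.
Qed.

Lemma sub_mod (n q x : N) : (n * q <=? x)%num -> (x - n * q)%num = x %[mod n].
Proof.
move=> le_x; have -> : nat_of_bin x = q * n + (x - n * q)%num by nia.
by rewrite modnMDl.
Qed.

Definition aurifeuille_factor (k : N) (s : bool) : N :=
  let h := ((k + 1) / 2)%num in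
  if s then (2 ^ k + 2 ^ h + 1)%num else (2 ^ k - 2 ^ h + 1)%num.

(** The inverse of the Aurifeuillian factor is [2 ^ - k * (1 -+ 2 ^ (h - k))] up
    to a relative error of about [2 ^ (1 - k)], where [k - h] is [k / 2].
    Shifts are much faster than a division by a number of this size. *)
Definition quotient_approx (k : N) (s : bool) (x : N) : N :=
  let y := N.shiftr x (k / 2) in
  N.shiftr (if s then x - y else x + y)%num k.

(** The quotients fall short by a few units, so [r1] is a few times [n] and the
    last remainder is [2] plus a multiple of [n]; [64] bounds it amply. *)
Definition quartic_check (k : N) (s : bool) (c : N) : bool :=
  let n := aurifeuille_factor k s in
  let x1 := N.square c in
  let q1 := (n * quotient_approx k s x1)%num in
  let r1 := (x1 - q1)%num in
  let x2 := N.square r1 in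
  let q2 := (n * quotient_approx k s x2)%num in
  let r2 := (x2 - q2)%num in
  [&& ~~ dvdN 2 k, (1 <? n)%num, (q1 <=? x1)%num, (q2 <=? x2)%num
    & has (fun j => r2 =? n * bin_of_nat j + 2)%num (iota 0 64)].

Lemma quartic_checkP (k : N) s (c : N) : quartic_check k s c -> excluded k.
Proof.
rewrite /quartic_check !N.square_spec; set n := aurifeuille_factor k s.
case/and5P; rewrite dvdNE dvdn2 negbK => k_odd n_gt1 /sub_mod r1 /sub_mod r2.
case/hasP=> j _ /N.eqb_eq def_r2; apply: (@excluded_quartic k n c).
- exact: odd_gt0.
- lia.
- have def_h : ((k + 1) / 2)%num = (k : nat).+1./2 :> nat.
    by rewrite nat_of_div nat_of_add addn1 divn2.
  rewrite -aurifeuille // /n /aurifeuille_factor; case: (s).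
    by rewrite !nat_of_add !nat_of_exp def_h dvdn_mull.
  by rewrite nat_of_add nat_of_sub !nat_of_exp def_h dvdn_mulr.
rewrite def_r2 nat_of_add nat_of_mul mulnC modnMDl in r2.
rewrite {}r2 nat_of_mul -modnMm r1 modnMm nat_of_mul.
by rewrite -[c ^ 4]/(c * (c * (c * c))) !mulnA.
Qed.

(** * The tables *)

Definition non_higgs_primes : seq entry := [::
  (17, 2, Trial); (97, 2, Trial); (103, 17, Trial); (113, 2, Trial);
  (137, 17, Trial); (163, 3, Trial); (193, 2, Trial); (227, 113, Trial);
  (239, 17, Trial); (241, 2, Trial); (257, 2, Trial); (307, 17, Trial);
  (337, 2, Trial); (353, 2, Trial); (389, 97, Trial); (401, 2, Trial);
  (409, 17, Trial); (433, 2, Trial); (443, 17, Trial); (449, 2, Trial);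
  (479, 239, Trial); (487, 3, Trial); (577, 2, Trial); (593, 2, Trial);
  (613, 17, Trial); (619, 103, Trial); (641, 2, Trial); (653, 163, Trial);
  (673, 2, Trial); (769, 2, Trial); (773, 193, Trial); (811, 3, Trial);
  (823, 137, Trial); (881, 2, Trial); (887, 443, Trial); (919, 17, Trial);
  (929, 2, Trial); (953, 17, Trial); (971, 97, Trial); (1009, 2, Trial);
  (1021, 17, Trial); (1031, 103, Trial); (1097, 137, Trial);
  (1123, 17, Trial); (1153, 2, Trial); (1187, 593, Trial); (1201, 2, Trial);
  (1217, 2, Trial); (1229, 307, Trial); (1237, 103, Trial); (1249, 2, Trial);
  (1259, 17, Trial); (1283, 641, Trial); (1297, 3, Trial); (1307, 653, Trial);
  (1327, 17, Trial); (1361, 2, Trial); (1409, 2, Trial); (1543, 257, Trial);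
  (1637, 409, Trial); (1733, 433, Trial); (1777, 2, Trial); (1873, 2, Trial);
  (1889, 2, Trial); (1907, 953, Trial); (1931, 193, Trial); (1973, 17, Trial);
  (2017, 2, Trial); (2063, 1031, Trial); (2081, 2, Trial); (2113, 2, Trial);
  (2129, 2, Trial); (2143, 17, Trial); (2161, 2, Trial); (2267, 103, Trial);
  (2269, 3, Trial); (2273, 2, Trial); (2309, 577, Trial); (2347, 17, Trial);
  (2381, 17, Trial); (2411, 241, Trial); (2417, 2, Trial);
  (2459, 1229, Trial); (2467, 137, Trial); (2473, 103, Trial);
  (2477, 619, Trial); (2609, 2, Trial); (2713, 113, Trial);
  (2819, 1409, Trial); (2833, 2, Trial); (2917, 3, Trial); (2939, 113, Trial);
  (3347, 239, Trial); (3361, 2, Trial); (3371, 337, Trial);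
  (3391, 113, Trial); (3457, 2, Trial); (3463, 577, Trial);
  (3467, 1733, Trial); (3469, 17, Trial); (3559, 593, Trial);
  (3571, 17, Trial); (3593, 449, Trial); (3617, 2, Trial); (3673, 17, Trial);
  (3677, 919, Trial); (3697, 2, Trial); (3709, 103, Trial); (3727, 3, Trial);
  (3761, 2, Trial); (3779, 1889, Trial); (3793, 2, Trial); (3833, 479, Trial);
  (3847, 641, Trial); (3863, 1931, Trial); (3877, 17, Trial);
  (3881, 97, Trial); (3889, 3, Trial); (3911, 17, Trial); (3919, 653, Trial);
  (3947, 1973, Trial); (4001, 2, Trial); (4013, 17, Trial); (4049, 2, Trial);
  (4051, 3, Trial); (4091, 409, Trial); (4111, 137, Trial);
  (4127, 2063, Trial); (4129, 2, Trial); (4339, 241, Trial);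
  (4463, 97, Trial); (4513, 2, Trial); (4919, 2459, Trial);
  (5303, 241, Trial); (5441, 2, Trial); (5639, 2819, Trial);
  (5849, 17, Trial); (5903, 227, Order 1824 13 [:: (13, 1)]);
  (6053, 17, Trial); (6113, 2, Trial); (6131, 613, Order 4261 5 [:: (5, 1)]);
  (6173, 1543, Trial); (7211, 103, Order 2599 7 [:: (7, 1)]);
  (7433, 929, Trial); (8101, 3, Trial); (8161, 2, Order 3076 5 [:: (5, 1)]);
  (8369, 2, Trial); (8609, 2, Trial); (8623, 479, Trial); (9929, 17, Trial);
  (10037, 193, Trial); (10039, 239, Order 7630 7 [:: (7, 1)]);
  (10091, 1009, Order 6311 5 [:: (5, 1)]);
  (10099, 17, Order 4343 17 [:: (17, 1)]);
  (10111, 337, Order 5829 3 [:: (3, 1)]); (10133, 17, Trial);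
  (10139, 137, Order 1802 37 [:: (37, 1)]);
  (10177, 2, Order 4096 53 [:: (53, 1)]);
  (10193, 2, Order 4193 13 [:: (13, 1)]);
  (10211, 1021, Order 6992 5 [:: (5, 1)]);
  (10273, 2, Order 2019 3 [:: (3, 1)]); (10289, 2, Trial);
  (10301, 103, Trial); (10303, 17, Order 4289 17 [:: (17, 1)]);
  (10321, 2, Order 7660 5 [:: (5, 1)]);
  (10337, 2, Order 9880 19 [:: (19, 1)]); (10369, 3, Trial);
  (10399, 1733, Order 444 3 [:: (3, 1)]);
  (10427, 401, Order 557 13 [:: (13, 1)]); (10433, 2, Trial);
  (10457, 1307, Trial); (10477, 97, Order 8466 4 [:: (2, 2)]);
  (10513, 2, Order 6156 9 [:: (3, 2)]);
  (10529, 2, Order 1834 47 [:: (47, 1)]);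
  (10531, 3, Order 4056 13 [:: (13, 1)]); (10607, 5303, Trial);
  (10657, 2, Order 4499 9 [:: (3, 2)]); (10663, 1777, Trial);
  (10687, 137, Order 3653 3 [:: (3, 1)]);
  (10711, 17, Order 5097 17 [:: (17, 1)]);
  (10753, 2, Order 1587 7 [:: (7, 1)]);
  (10847, 17, Order 2639 11 [:: (11, 1)]);
  (10853, 2713, Order 2573 4 [:: (2, 2)]); (10883, 5441, Trial);
  (10889, 1361, Trial); (10949, 17, Order 5556 23 [:: (23, 1)]);
  (10993, 2, Order 9448 3 [:: (3, 1)]); (11057, 2, Order 7702 4 [:: (2, 2)]);
  (11059, 97, Order 6752 3 [:: (3, 1)]);
  (11087, 241, Order 6719 23 [:: (23, 1)]);
  (11119, 17, Order 8 17 [:: (17, 1)]);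
  (11149, 929, Order 4438 3 [:: (3, 1)]);
  (11239, 1873, Order 5672 3 [:: (3, 1)]);
  (11251, 5, Order 9844 9 [:: (3, 2)]);
  (11273, 1409, Order 4043 4 [:: (2, 2)]); (11279, 5639, Trial);
  (11329, 2, Order 1227 3 [:: (3, 1)]); (11351, 227, Trial);
  (11393, 2, Trial); (11411, 163, Order 9889 7 [:: (7, 1)]);
  (11437, 953, Order 2417 3 [:: (3, 1)]); (11443, 1907, Trial);
  (11447, 97, Order 2 97 [:: (97, 1)]); (11489, 2, Trial);
  (11497, 479, Order 10046 3 [:: (3, 1)]); (11503, 3, Trial);
  (11519, 443, Order 1822 13 [:: (13, 1)]);
  (11527, 17, Order 5517 3 [:: (3, 1)]); (11587, 1931, Trial);
  (11617, 2, Order 9023 3 [:: (3, 1)]); (11633, 2, Trial);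
  (11681, 2, Order 917 73 [:: (73, 1)]);
  (11689, 487, Order 1900 3 [:: (3, 1)]); (11699, 5849, Trial);
  (11731, 17, Order 1619 23 [:: (23, 1)]);
  (11743, 103, Order 8585 3 [:: (3, 1)]);
  (11777, 2, Order 11297 23 [:: (23, 1)]);
  (11783, 137, Order 9828 43 [:: (43, 1)]); (11807, 5903, Trial);
  (11827, 3, Order 9855 73 [:: (73, 1)]);
  (11833, 17, Order 4364 29 [:: (29, 1)]);
  (11839, 1973, Order 11159 3 [:: (3, 1)]);
  (11867, 17, Order 9694 17 [:: (17, 1)]);
  (11953, 2, Order 5340 9 [:: (3, 2)]);
  (11969, 2, Order 9297 17 [:: (17, 1)]);
  (12011, 1201, Order 2557 5 [:: (5, 1)]);
  (12037, 17, Order 1293 3 [:: (3, 1)]); (12049, 2, Order 685 3 [:: (3, 1)]);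
  (12071, 17, Order 5811 5 [:: (5, 1)]);
  (12097, 2, Order 11401 7 [:: (7, 1)]); (12107, 6053, Trial);
  (12109, 1009, Order 3432 3 [:: (3, 1)]);
  (12113, 2, Order 3281 8 [:: (2, 3)]);
  (12161, 2, Order 5153 19 [:: (19, 1)]); (12227, 6113, Trial);
  (12241, 2, Order 10268 17 [:: (17, 1)]);
  (12253, 1021, Order 482 3 [:: (3, 1)]); (12263, 6131, Trial);
  (12281, 307, Order 6760 4 [:: (2, 2)]);
  (12289, 2, Order 6048 3 [:: (3, 1)]);
  (12343, 17, Order 5460 17 [:: (17, 1)]); (12347, 6173, Trial);
  (12373, 1031, Order 10876 3 [:: (3, 1)]);
  (12377, 17, Order 5048 7 [:: (7, 1)]); (12379, 2063, Trial);
  (12401, 2, Order 7130 31 [:: (31, 1)]);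
  (12433, 2, Order 3325 7 [:: (7, 1)]);
  (12479, 17, Order 8470 17 [:: (17, 1)]);
  (12487, 2081, Order 5033 3 [:: (3, 1)]);
  (12491, 1249, Order 1964 5 [:: (5, 1)]);
  (12497, 2, Order 3965 4 [:: (2, 2)]); (12577, 2, Order 4814 3 [:: (3, 1)]);
  (13367, 163, Order 2 41 [:: (41, 1)]);
  (14753, 2, Order 10670 4 [:: (2, 2)]);
  (15649, 2, Order 10200 3 [:: (3, 1)]); (16673, 2, Order 1954 4 [:: (2, 2)]);
  (18289, 2, Order 4067 127 [:: (127, 1)]);
  (19889, 2, Order 7446 113 [:: (113, 1)]);
  (19993, 17, Order 19343 17 [:: (17, 1)]);
  (20333, 17, Order 15590 23 [:: (23, 1)]);
  (21377, 2, Order 20241 167 [:: (167, 1)]);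
  (21647, 137, Order 17578 79 [:: (79, 1)]);
  (22129, 2, Order 19626 3 [:: (3, 1)]);
  (22679, 17, Order 21625 29 [:: (29, 1)]);
  (24103, 103, Order 11630 9 [:: (3, 2)]);
  (24359, 641, Order 1238 19 [:: (19, 1)]);
  (25247, 971, Order 13663 13 [:: (13, 1)]);
  (25409, 2, Order 19256 4 [:: (2, 2)]);
  (25793, 2, Order 20428 31 [:: (31, 1)]);
  (25889, 2, Order 18284 4 [:: (2, 2)]);
  (26417, 2, Order 16 127 [:: (127, 1)]);
  (26431, 881, Order 2 881 [:: (881, 1)]);
  (26669, 113, Order 16670 113 [:: (113, 1)]);
  (27241, 227, Order 19499 5 [:: (5, 1)]);
  (29153, 2, Order 3871 4 [:: (2, 2)]); (32321, 2, Order 5549 5 [:: (5, 1)]);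
  (35537, 2, Order 1738 4 [:: (2, 2)]); (36833, 2, Order 31940 4 [:: (2, 2)]);
  (37201, 2, Order 6948 31 [:: (31, 1)]);
  (37217, 2, Order 26855 4 [:: (2, 2)]);
  (37633, 2, Order 21328 49 [:: (7, 2)]);
  (39409, 2, Order 1502 16 [:: (2, 4)]); (39779, 19889, Trial);
  (41233, 2, Order 6355 16 [:: (2, 4)]);
  (42193, 2, Order 18040 9 [:: (3, 2)]);
  (48341, 2417, Order 3148 4 [:: (2, 2)]);
  (54001, 2, Order 22557 9 [:: (3, 2)]);
  (54833, 2, Order 18991 149 [:: (149, 1)]);
  (57329, 2, Order 39460 16 [:: (2, 4)]);
  (61297, 2, Order 39203 16 [:: (2, 4)]);
  (63409, 2, Order 17052 16 [:: (2, 4)]);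
  (64433, 2, Order 19080 16 [:: (2, 4)]);
  (71777, 2, Order 42617 32 [:: (2, 5)]);
  (75979, 3, Order 6089 7 [:: (7, 1)]); (79559, 39779, Trial);
  (103837, 17, Order 16 509 [:: (509, 1)]);
  (111697, 2, Order 81919 13 [:: (13, 1)]);
  (114161, 2, Order 3750 16 [:: (2, 4)]);
  (114593, 2, Order 93978 32 [:: (2, 5)]);
  (115153, 2, Order 10943 16 [:: (2, 4)]);
  (116911, 433, Order 100179 27 [:: (3, 3)]);
  (118411, 3947, Order 64045 15 [:: (3, 1); (5, 1)]);
  (136189, 97, Order 44594 13 [:: (13, 1)]);
  (151483, 25247, Order 23825 6 [:: (2, 1); (3, 1)]);
  (154097, 2, Order 133717 16 [:: (2, 4)]);
  (157649, 2, Order 16 59 [:: (59, 1)]);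
  (161233, 2, Order 51407 16 [:: (2, 4)]);
  (161873, 2, Order 135784 151 [:: (151, 1)]);
  (163697, 2, Order 57009 787 [:: (787, 1)]);
  (165713, 2, Order 88498 16 [:: (2, 4)]);
  (167249, 2, Order 145472 16 [:: (2, 4)]);
  (171793, 2, Order 80272 16 [:: (2, 4)]);
  (172433, 2, Order 13895 829 [:: (829, 1)]);
  (174481, 2, Order 1690 727 [:: (727, 1)]);
  (176753, 2, Order 121876 16 [:: (2, 4)]);
  (178909, 17, Order 75018 17 [:: (17, 1)]);
  (182129, 2, Order 31956 16 [:: (2, 4)]);
  (183761, 2, Order 137638 16 [:: (2, 4)]);
  (184337, 2, Order 93445 281 [:: (281, 1)]);
  (191441, 2, Order 147060 16 [:: (2, 4)]);
  (194609, 2, Order 83119 16 [:: (2, 4)]);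
  (195281, 2, Order 175482 16 [:: (2, 4)]);
  (199931, 19993, Order 68237 10 [:: (2, 1); (5, 1)]);
  (246241, 3, Order 226254 19 [:: (19, 1)]);
  (281641, 2347, Order 15323 15 [:: (3, 1); (5, 1)]);
  (281683, 15649, Order 125305 18 [:: (2, 1); (3, 2)]);
  (283631, 113, Order 233505 113 [:: (113, 1)]);
  (311177, 97, Order 144483 97 [:: (97, 1)]);
  (322051, 113, Order 83834 113 [:: (113, 1)]);
  (330017, 2, Order 309172 32 [:: (2, 5)]);
  (340129, 2, Order 4096 1181 [:: (1181, 1)]);
  (347489, 2, Order 4368 32 [:: (2, 5)]);
  (365089, 2, Order 147719 32 [:: (2, 5)]);
  (382241, 2, Order 310300 32 [:: (2, 5)]);
  (390193, 2, Order 4096 739 [:: (739, 1)]);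
  (391009, 2, Order 23550 32 [:: (2, 5)]);
  (392929, 2, Order 224185 32 [:: (2, 5)]);
  (393713, 2, Order 126387 16 [:: (2, 4)]);
  (394529, 2, Order 268040 32 [:: (2, 5)]);
  (402359, 18289, Order 82966 11 [:: (11, 1)]);
  (414641, 2, Order 165865 73 [:: (73, 1)]);
  (468353, 2, Order 16 3659 [:: (3659, 1)]);
  (475421, 2161, Order 9647 2161 [:: (2161, 1)]);
  (477769, 17, Order 4096 1171 [:: (1171, 1)]);
  (493169, 2, Order 116353 16 [:: (2, 4)]);
  (500177, 2, Order 16 43 [:: (43, 1)]);
  (525313, 2, Order 16 19 [:: (19, 1)]);
  (550609, 2, Order 318462 16 [:: (2, 4)]);
  (554641, 2, Order 419710 16 [:: (2, 4)]);
  (562897, 2, Order 448079 1303 [:: (1303, 1)]);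
  (581521, 2, Order 423974 16 [:: (2, 4)]);
  (585889, 2, Order 16 359 [:: (359, 1)]);
  (601949, 2467, Order 139220 2467 [:: (2467, 1)]);
  (605933, 151483, Order 205835 4 [:: (2, 2)]);
  (616481, 2, Order 186306 32 [:: (2, 5)]);
  (669377, 2, Order 112788 64 [:: (2, 6)]);
  (695377, 2, Order 16 439 [:: (439, 1)]);
  (715073, 2, Order 136302 64 [:: (2, 6)]);
  (760769, 2, Order 485445 64 [:: (2, 6)]);
  (779621, 17, Order 268955 2293 [:: (2293, 1)]);
  (819761, 2, Order 626349 16 [:: (2, 4)]);
  (846961, 2, Order 16 3529 [:: (3529, 1)]);
  (848803, 241, Order 472958 587 [:: (587, 1)]);
  (865681, 2, Order 16 3607 [:: (3607, 1)]);
  (867553, 2, Order 4096 1291 [:: (1291, 1)]);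
  (887441, 2, Order 536110 16 [:: (2, 4)]);
  (927137, 2, Order 783775 32 [:: (2, 5)]);
  (980081, 2, Order 85171 16 [:: (2, 4)]);
  (1137809, 2, Order 891367 16 [:: (2, 4)]);
  (1153441, 3, Order 1048576 89 [:: (89, 1)]);
  (1161137, 2, Order 16 2341 [:: (2341, 1)]);
  (1162529, 2, Order 16 2137 [:: (2137, 1)]);
  (1203899, 601949, Order 2 1203898 [:: (601949, 1)]);
  (1207511, 17, Order 434323 17 [:: (17, 1)]);
  (1281089, 2, Order 16 541 [:: (541, 1)]);
  (1345921, 2, Order 157523 701 [:: (701, 1)]);
  (1372369, 2, Order 1263539 16 [:: (2, 4)]);
  (1408349, 17, Order 314332 149 [:: (149, 1)]);
  (1451257, 17, Order 763988 17 [:: (17, 1)]);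
  (1501777, 2, Order 1283199 16 [:: (2, 4)]);
  (1567661, 103, Order 16 761 [:: (761, 1)]);
  (1590521, 17, Order 1048576 2339 [:: (2339, 1)]);
  (1772033, 2, Order 16 3461 [:: (3461, 1)]);
  (1804609, 2, Order 889772 241 [:: (241, 1)]);
  (1836959, 48341, Order 997126 19 [:: (19, 1)]);
  (1905121, 3, Order 414767 49 [:: (7, 2)]);
  (2034017, 2, Order 16 3739 [:: (3739, 1)]);
  (2071457, 2, Order 16 3407 [:: (3407, 1)]);
  (2157709, 17, Order 477020 1511 [:: (1511, 1)]);
  (2169031, 17, Order 338179 4253 [:: (4253, 1)]);
  (2206769, 2, Order 16 1289 [:: (1289, 1)]);
  (2261569, 2, Order 756734 64 [:: (2, 6)]);
  (2269049, 283631, Order 2212945 8 [:: (2, 3)]);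
  (2271553, 2, Order 764881 64 [:: (2, 6)]);
  (2284241, 2, Order 16 4079 [:: (4079, 1)]);
  (2407799, 1203899, Order 2 1203899 [:: (1203899, 1)]);
  (2491457, 2, Order 16 3539 [:: (3539, 1)]);
  (2606393, 4463, Order 2435244 4463 [:: (4463, 1)]);
  (2889457, 2, Order 16 3541 [:: (3541, 1)]);
  (3122321, 2, Order 2354768 1259 [:: (1259, 1)]);
  (3315509, 118411, Order 428017 28 [:: (2, 2); (7, 1)]);
  (3401561, 307, Order 2960784 307 [:: (307, 1)]);
  (3673919, 1836959, Order 2 1836959 [:: (1836959, 1)]);
  (3778421, 17, Order 16 11113 [:: (11113, 1)]);
  (3856273, 2, Order 3072989 499 [:: (499, 1)]);
  (3919441, 2, Order 1048576 2333 [:: (2333, 1)]);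
  (4082857, 17, Order 1541991 51 [:: (3, 1); (17, 1)]);
  (4196897, 2, Order 3626291 32 [:: (2, 5)]);
  (4289633, 2, Order 16 3623 [:: (3623, 1)]);
  (4496497, 2, Order 4096 829 [:: (829, 1)]);
  (4501009, 3, Order 1026965 151 [:: (151, 1)]);
  (4582241, 2, Order 1048576 2203 [:: (2203, 1)]);
  (4638553, 17, Order 16 11369 [:: (11369, 1)]);
  (4907041, 2, Order 16 10223 [:: (10223, 1)]);
  (5080081, 2, Order 3070020 347 [:: (347, 1)]);
  (5212787, 2606393, Order 2 5212786 [:: (2606393, 1)]);
  (5328641, 2, Order 2775038 181 [:: (181, 1)]);
  (5364257, 2, Order 292178 32 [:: (2, 5)]);
  (5376577, 2, Order 4096 683 [:: (683, 1)]);
  (5490593, 2, Order 16 10093 [:: (10093, 1)]);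
  (5517521, 2, Order 16 4057 [:: (4057, 1)]);
  (5575597, 103, Order 16 347 [:: (347, 1)]);
  (5884973, 137, Order 16 10739 [:: (10739, 1)]);
  (7217953, 2, Order 4630165 467 [:: (467, 1)]);
  (7289959, 4919, Order 4641511 4919 [:: (4919, 1)]);
  (7486733, 17, Order 16 10009 [:: (10009, 1)]);
  (7593913, 3, Order 16 11719 [:: (11719, 1)]);
  (7597901, 75979, Order 847217 100 [:: (2, 2); (5, 2)]);
  (7770337, 2, Order 2994800 373 [:: (373, 1)]);
  (8633489, 2, Order 16 10181 [:: (10181, 1)]);
  (9192097, 2, Order 16 10639 [:: (10639, 1)]);
  (10136593, 2, Order 2762099 144 [:: (2, 4); (3, 2)]);
  (10180721, 2, Order 8343727 503 [:: (503, 1)]);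
  (10547521, 2, Order 16 10987 [:: (10987, 1)]);
  (10652513, 2, Order 8453211 883 [:: (883, 1)]);
  (11785001, 5, Order 1048576 2357 [:: (2357, 1)]);
  (12152177, 2, Order 16 12451 [:: (12451, 1)]);
  (12181409, 2, Order 16 3769 [:: (3769, 1)]);
  (12527573, 17, Order 16 10837 [:: (10837, 1)]);
  (12648113, 2, Order 2174742 2917 [:: (2917, 1)]);
  (12902117, 17, Order 16 11161 [:: (11161, 1)]);
  (12903563, 353, Order 3098140 373 [:: (373, 1)]);
  (13063537, 2, Order 16 83 [:: (83, 1)]);
  (13487801, 17, Order 16 3967 [:: (3967, 1)]);
  (15358129, 2, Order 16 53 [:: (53, 1)]);
  (16964033, 2, Order 16 3631 [:: (3631, 1)]);
  (17036017, 2, Order 15517790 257 [:: (257, 1)]);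
  (17717941, 3, Order 11848716 81 [:: (3, 4)]);
  (18955169, 2, Order 16 3547 [:: (3547, 1)]);
  (19936481, 2, Order 16 2351 [:: (2351, 1)]);
  (20841181, 163, Order 1048576 2131 [:: (2131, 1)]);
  (21418801, 2, Order 4096 1373 [:: (1373, 1)]);
  (22038721, 2, Order 1048576 2087 [:: (2087, 1)]);
  (22113937, 2, Order 16 11813 [:: (11813, 1)]);
  (23610869, 479, Order 16 12323 [:: (12323, 1)]);
  (23864693, 593, Order 16 10061 [:: (10061, 1)]);
  (25180577, 2, Order 16 11083 [:: (11083, 1)]);
  (25212001, 2, Order 16 191 [:: (191, 1)]);
  (25425551, 103, Order 17395959 103 [:: (103, 1)]);
  (25884577, 2, Order 3537061 29959 [:: (29959, 1)]);
  (25945561, 97, Order 1048576 743 [:: (743, 1)]);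
  (32123681, 2, Order 16 10567 [:: (10567, 1)]);
  (34320553, 17, Order 25616107 197 [:: (197, 1)]);
  (35067533, 17, Order 848347 179 [:: (179, 1)]);
  (36302737, 2, Order 4096 787 [:: (787, 1)]);
  (37160393, 389, Order 16 11941 [:: (11941, 1)]);
  (37690441, 443, Order 4096 709 [:: (709, 1)]);
  (38097113, 1361, Order 16 3499 [:: (3499, 1)]);
  (38423089, 2, Order 6798629 191 [:: (191, 1)]);
  (39793153, 2, Order 16 3701 [:: (3701, 1)]);
  (39914321, 2, Order 22769308 283 [:: (283, 1)]);
  (39935041, 2, Order 1048576 2447 [:: (2447, 1)]);
  (45092093, 17, Order 16 2053 [:: (2053, 1)]);
  (45595709, 1097, Order 38484589 1097 [:: (1097, 1)]);
  (46475941, 239, Order 16 463 [:: (463, 1)]);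
  (46616897, 2, Order 16 10259 [:: (10259, 1)]);
  (46807781, 3457, Order 1048576 677 [:: (677, 1)]);
  (56453377, 2, Order 16 10501 [:: (10501, 1)]);
  (56611769, 17, Order 49936305 136 [:: (2, 3); (17, 1)]);
  (60000349, 487, Order 21274518 487 [:: (487, 1)]);
  (60079057, 2, Order 40767216 109 [:: (109, 1)]);
  (62984381, 137, Order 1048576 181 [:: (181, 1)]);
  (68031221, 3401561, Order 1048576 3401561 [:: (3401561, 1)]);
  (70019321, 113, Order 1048576 2213 [:: (2213, 1)]);
  (75005713, 2, Order 29087369 3119 [:: (3119, 1)]);
  (83757797, 1973, Order 16 10613 [:: (10613, 1)]);
  (91438993, 2, Order 16 11981 [:: (11981, 1)]);
  (94453061, 103, Order 16 3527 [:: (3527, 1)]);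
  (94622981, 26431, Order 1048576 179 [:: (179, 1)]);
  (94637713, 2, Order 4096 4099 [:: (4099, 1)]);
  (101884753, 2, Order 16 2039 [:: (2039, 1)]);
  (107367629, 113, Order 97781882 8191 [:: (8191, 1)]);
  (110831629, 116911, Order 93993850 237 [:: (3, 1); (79, 1)]);
  (111650629, 17, Order 16 383 [:: (383, 1)]);
  (114168529, 3, Order 112440555 81 [:: (3, 4)]);
  (116219821, 17, Order 4096 3929 [:: (3929, 1)]);
  (120323153, 2, Order 42605713 661 [:: (661, 1)]);
  (122074889, 97, Order 16 12101 [:: (12101, 1)]);
  (126376109, 2917, Order 16 10831 [:: (10831, 1)]);
  (127015129, 3, Order 4096 751 [:: (751, 1)]);
  (127620817, 2, Order 16 2437 [:: (2437, 1)]);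
  (148587949, 953, Order 7849381 953 [:: (953, 1)]);
  (160022449, 2, Order 16 10789 [:: (10789, 1)]);
  (162283501, 3, Order 4096 4007 [:: (4007, 1)]);
  (180201997, 3, Order 138747093 1097 [:: (1097, 1)]);
  (180361969, 2, Order 16 2287 [:: (2287, 1)]);
  (199478897, 2, Order 16 12211 [:: (12211, 1)]);
  (204118853, 7289959, Order 64316603 7289959 [:: (7289959, 1)]);
  (222233953, 2, Order 19354338 29303 [:: (29303, 1)]);
  (223057621, 1637, Order 207675652 757 [:: (757, 1)]);
  (225112189, 239, Order 16 11213 [:: (11213, 1)]);
  (244210441, 17, Order 1048576 2029 [:: (2029, 1)]);
  (245207477, 311177, Order 169746597 788 [:: (2, 2); (197, 1)]);
  (261029173, 5849, Order 4096 3719 [:: (3719, 1)]);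
  (272179657, 17, Order 16 10589 [:: (10589, 1)]);
  (279811361, 2, Order 159516291 1549 [:: (1549, 1)]);
  (284378881, 2, Order 1048576 719 [:: (719, 1)]);
  (286508473, 3571, Order 271955590 3571 [:: (3571, 1)]);
  (286871281, 2, Order 16 11171 [:: (11171, 1)]);
  (306823141, 3, Order 165246795 857 [:: (857, 1)]);
  (349949137, 2, Order 4096 3943 [:: (3943, 1)]);
  (408187327, 68031221, Order 2 204093663 [:: (68031221, 1)]);
  (408237707, 204118853, Order 2 408237706 [:: (204118853, 1)]);
  (425654561, 2, Order 16 529 [:: (23, 2)]);
  (468863573, 241, Order 16 11311 [:: (11311, 1)]);
  (486733669, 2939, Order 190794047 2939 [:: (2939, 1)]);
  (493701421, 17, Order 4096 3533 [:: (3533, 1)]);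
  (501979733, 10289, Order 16 12197 [:: (12197, 1)]);
  (544515997, 11783, Order 16 3851 [:: (3851, 1)]);
  (595917253, 17, Order 188992641 1231 [:: (1231, 1)]);
  (670697201, 2, Order 16 12239 [:: (12239, 1)]);
  (765024817, 2, Order 16 11491 [:: (11491, 1)]);
  (812836153, 227, Order 4096 1213 [:: (1213, 1)]);
  (813058517, 103, Order 16 10903 [:: (10903, 1)]);
  (844293809, 2, Order 16 11677 [:: (11677, 1)]);
  (884922293, 21377, Order 158260255 21377 [:: (21377, 1)]);
  (941203313, 2, Order 16 12413 [:: (12413, 1)]);
  (974668193, 2, Order 16 11801 [:: (11801, 1)]);
  (1029356261, 641, Order 16 3491 [:: (3491, 1)]);
  (1181029153, 2, Order 581824105 1019 [:: (1019, 1)]);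
  (1293760033, 2, Order 4096 3821 [:: (3821, 1)]);
  (1343873213, 2833, Order 16 10781 [:: (10781, 1)]);
  (1353013099, 479, Order 1079044877 6449 [:: (6449, 1)]);
  (1440383213, 239, Order 16 947 [:: (947, 1)]);
  (1456914689, 2, Order 16 10799 [:: (10799, 1)]);
  (1690482449, 2, Order 943022793 521 [:: (521, 1)]);
  (1714710013, 37633, Order 4096 3797 [:: (3797, 1)]);
  (1748832017, 2, Order 16 491 [:: (491, 1)]);
  (1922336587, 103, Order 532487286 24113 [:: (24113, 1)]);
  (1928991847, 2157709, Order 644066820 2157709 [:: (2157709, 1)]);
  (1983807677, 137, Order 16 3767 [:: (3767, 1)]);
  (2018563123, 22129, Order 39085895 22129 [:: (22129, 1)]);
  (2111953661, 10477, Order 16 10079 [:: (10079, 1)]);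
  (2139125689, 1021, Order 4096 4157 [:: (4157, 1)]);
  (2204431393, 2, Order 1724610499 2281 [:: (2281, 1)]);
  (2306845657, 3, Order 2184745046 379 [:: (379, 1)]);
  (2649603977, 881, Order 731157737 881 [:: (881, 1)]);
  (2790467761, 2, Order 2072487371 719 [:: (719, 1)]);
  (2909152009, 4513, Order 1927726409 4513 [:: (4513, 1)]);
  (2992293649, 2, Order 787784825 28349 [:: (28349, 1)]);
  (3319213489, 2, Order 16 3637 [:: (3637, 1)]);
  (3502383233, 2, Order 16 11933 [:: (11933, 1)]);
  (3703040513, 2, Order 16 4159 [:: (4159, 1)]);
  (3745206349, 823, Order 228317043 941 [:: (941, 1)]);
  (4214531441, 2, Order 16 3691 [:: (3691, 1)]);
  (4873284601, 17, Order 315622983 11653 [:: (43, 1); (271, 1)]);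
  (5013569381, 24359, Order 4217224420 24359 [:: (24359, 1)]);
  (5805133777, 2, Order 63709004 907 [:: (907, 1)]);
  (6245346421, 26669, Order 20666105 1301 [:: (1301, 1)]);
  (6338490337, 2, Order 16 11903 [:: (11903, 1)]);
  (10029687793, 2, Order 4096 4019 [:: (4019, 1)]);
  (10155866849, 2, Order 16 11863 [:: (11863, 1)]);
  (10976956477, 577, Order 16 10499 [:: (10499, 1)]);
  (12937984121, 154097, Order 16 2099 [:: (2099, 1)]);
  (13161276481, 2, Order 16 3907 [:: (3907, 1)]);
  (13625405957, 17, Order 8149124941 50689 [:: (173, 1); (293, 1)]);
  (13995138173, 281683, Order 16 12421 [:: (12421, 1)]);
  (14501312429, 322051, Order 16 11257 [:: (11257, 1)]);
  (14878831453, 114161, Order 16 10861 [:: (10861, 1)]);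
  (15363977641, 971, Order 16 11987 [:: (11987, 1)]);
  (15848680513, 2, Order 16 10691 [:: (10691, 1)]);
  (18180075259, 2477, Order 10085898678 5743 [:: (5743, 1)]);
  (18912482437, 402359, Order 4096 3917 [:: (3917, 1)]);
  (21597425189, 475421, Order 16 11357 [:: (41, 1); (277, 1)]);
  (22050695561, 8161, Order 12018407352 8161 [:: (8161, 1)]);
  (31463442317, 3673919, Order 16 2141 [:: (2141, 1)]);
  (31613686813, 17, Order 4096 3433 [:: (3433, 1)]);
  (40500429577, 136189, Order 16 12391 [:: (12391, 1)]);
  (42539437393, 2, Order 32632709662 3761 [:: (3761, 1)]);
  (52029326689, 2, Order 16 11771 [:: (79, 1); (149, 1)]);
  (52978095421, 12487, Order 39668570145 12487 [:: (12487, 1)]);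
  (53752704757, 21647, Order 16 10891 [:: (10891, 1)]);
  (57204846557, 673, Order 16 10673 [:: (13, 1); (821, 1)]);
  (59156686733, 487, Order 16 11177 [:: (11177, 1)]);
  (85762271389, 22679, Order 70914814087 22679 [:: (22679, 1)]);
  (90523543793, 2, Order 56620320344 47699 [:: (47699, 1)]);
  (117765004537, 17, Order 41030123826 26209 [:: (26209, 1)]);
  (125713824277, 24103, Order 39444445436 24103 [:: (24103, 1)]);
  (139045402549, 3, Order 16 11579 [:: (11579, 1)]);
  (139423082437, 199931, Order 10914018765 199931 [:: (199931, 1)]);
  (191206853953, 2, Order 4096 3413 [:: (3413, 1)]);
  (217829953477, 1327, Order 214654599997 3457 [:: (3457, 1)]);
  (221157147961, 3, Order 2 8276 [:: (2, 2); (2069, 1)]);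
  (232597562581, 1307, Order 16 10631 [:: (10631, 1)]);
  (249304820549, 17, Order 16 10103 [:: (10103, 1)]);
  (272492464241, 2, Order 2 8612 [:: (2, 2); (2153, 1)]);
  (347949588631, 12648113, Order 217311877572 12648113 [:: (12648113, 1)]);
  (385779418529, 2, Order 16 12143 [:: (12143, 1)]);
  (490768775201, 2, Order 16 11621 [:: (11621, 1)]);
  (494930932337, 2, Order 16 10973 [:: (10973, 1)]);
  (585432248861, 2407799, Order 27419650500 2407799 [:: (2407799, 1)]);
  (676544454893, 2609, Order 16 10243 [:: (10243, 1)]);
  (729297469909, 3, Order 2 47172 [:: (2, 2); (3931, 1)]);
  (1131019499249, 2, Order 482335152124 20441 [:: (20441, 1)]);
  (1230855683509, 2169031, Order 867494831924 2169031 [:: (2169031, 1)]);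
  (1340181078869, 414641, Order 16 11069 [:: (11069, 1)]);
  (1393212736417, 2, Order 968829709591 70409 [:: (181, 1); (389, 1)]);
  (1799012656433, 2, Order 16 11423 [:: (11423, 1)]);
  (1813098135161, 17, Order 16 10271 [:: (10271, 1)]);
  (2393866477753, 25425551, Order 2016512281718 25425551 [:: (25425551, 1)]);
  (2509615483867, 139423082437, Order 2 836538494622 [:: (139423082437, 1)]);
  (2692423124273, 2, Order 2670634434255 11867 [:: (11867, 1)]);
  (3858429268997, 17, Order 1763296631561 246017 [:: (246017, 1)]);
  (3976061058737, 2, Order 2 40652 [:: (2, 2); (10163, 1)]);
  (4912537097393, 2, Order 2599661002234 25367 [:: (25367, 1)]);
  (5655412315681, 2, Order 4412082150026 15427 [:: (15427, 1)]);
  (5998435712461, 257, Order 2916725491755 3162631 [:: (1433, 1); (2207, 1)]);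
  (6306332272417, 2, Order 168413275663 2831629 [:: (821, 1); (3449, 1)]);
  (7400704853629, 3, Order 4355033902915 43517 [:: (43517, 1)]);
  (9167549549281, 2, Order 8834345941550 128951 [:: (128951, 1)]);
  (10955646370897, 2, Order 725094174510 616111 [:: (616111, 1)]);
  (11141233576769, 2, Order 5677652301142 205619 [:: (205619, 1)]);
  (12684209091481, 3315509, Order 3092676875727 3315509 [:: (3315509, 1)]);
  (14068894694089, 7211, Order 2 47284 [:: (2, 2); (11821, 1)]);
  (14497117305841, 2, Order 1953475654889 78031 [:: (78031, 1)]);
  (23528569104401, 2, Order 12769645268687 41231 [:: (41231, 1)]);
  (25479896548961, 2, Order 19621848910051 9546751 [:: (2441, 1); (3911, 1)]);
  (27547678215997, 1372369, Order 26330969281142 1372369 [:: (1372369, 1)]);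
  (28182529378873, 17, Order 23458410701904 175499 [:: (175499, 1)]);
  (31125492783457, 2, Order 2 41332 [:: (2, 2); (10333, 1)]);
  (31940473797629, 113, Order 2 40804 [:: (2, 2); (101, 2)]);
  (47246087122121, 3122321, Order 25817809236248 3122321 [:: (3122321, 1)]);
  (55628387418193, 114168529, Order 1146752531014 114168529 [:: (114168529,
   1)]);
  (64007056091437, 848803, Order 13119245137436 848803 [:: (848803, 1)]);
  (74323515777853, 7433, Order 57399483440671 3441479 [:: (463, 1); (7433,
   1)]);
  (75253947274969, 8623, Order 2 43828 [:: (2, 2); (10957, 1)]);
  (75682086345727, 2017, Order 35081768834728 42357 [:: (3, 1); (7, 1);
   (2017, 1)]);
  (144699558189821, 110831629, Order 111424623809048 110831629 [::
   (110831629, 1)]);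
  (145240175444293, 3, Order 42265235238213 79817 [:: (79817, 1)]);
  (188771118598021, 605933, Order 139819569738258 605933 [:: (605933, 1)]);
  (194168203811293, 1353013099, Order 165185195162407 1353013099 [::
   (1353013099, 1)]);
  (261508343832349, 17, Order 13641319446296 137836 [:: (2, 2); (17, 1);
   (2027, 1)]);
  (390435640334053, 5212787, Order 90212927781231 5212787 [:: (5212787, 1)]);
  (434544194059769, 281641, Order 98191879794926 281641 [:: (281641, 1)]);
  (505238158438001, 2, Order 62550914565808 124493 [:: (124493, 1)]);
  (524704862656309, 307, Order 198519762683733 1006651 [:: (1006651, 1)]);
  (614642118801013, 433, Order 592438872650491 277553 [:: (433, 1); (641,
   1)]);
  (618176726615857, 2, Order 31528719180016 1835543 [:: (163, 1); (11261,
   1)]);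
  (714228521270221, 1928991847, Order 377022234646578 1928991847 [::
   (1928991847, 1)]);
  (830680803436697, 408187327, Order 649111895284206 408187327 [::
   (408187327, 1)]);
  (923747384684497, 2, Order 576230649897505 67988911 [:: (5479, 1); (12409,
   1)]);
  (1257703940416129, 2, Order 870470826503981 421397 [:: (421397, 1)]);
  (1369926123307673, 2018563123, Order 919551566324885 2018563123 [::
   (2018563123, 1)]);
  (1842150665843953, 18180075259, Order 64723818939728 18180075259 [::
   (18180075259, 1)]);
  (2651916413187229, 12107, Order 1672236667839455 248786743 [:: (12107, 1);
   (20549, 1)]);
  (4048080173520637, 401, Order 963207911755253 512021 [:: (512021, 1)]);
  (4285371127621327, 714228521270221, Order 2 2142685563810663 [::
   (714228521270221, 1)]);
  (6027043735173469, 27241, Order 3945639301037350 2981282281 [:: (27241, 1);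
   (109441, 1)]);
  (9340175422135301, 13367, Order 1764706417438139 369076237 [:: (13367, 1);
   (27611, 1)]);
  (12391206418616453, 5364257, Order 9265121721843771 5364257 [:: (5364257,
   1)]);
  (48308911265022449, 2, Order 12540870121583984 707173 [:: (61, 1); (11593,
   1)]);
  (49535645924372161, 2, Order 39010208896497821 3101125739 [:: (28933, 1);
   (107183, 1)]);
  (52484608344350561, 486733669, Order 27264914332813592 486733669 [::
   (486733669, 1)]);
  (158443977800643593, 222233953, Order 119790241699574266 222233953 [::
   (222233953, 1)]);
  (228528049218195313, 2, Order 147508375826723320 799388869 [:: (1117, 1);
   (715657, 1)]);
  (263717472998966521, 3617, Order 208480149486405463 239302067 [:: (11551,
   1); (20717, 1)]);
  (282224116408338869, 245207477, Order 164337496662391 245207477 [::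
   (245207477, 1)]);
  (291599907662880149, 337, Order 108521948804311928 2259161 [:: (2259161,
   1)]);
  (463426974911171041, 2, Order 68265971811486813 6002206141 [:: (6829, 1);
   (878929, 1)]);
  (855540009786755257, 7597901, Order 542887061218863657 7597901 [::
   (7597901, 1)]);
  (876970426585550701, 2473, Order 8122463364230716 57151291 [:: (4799, 1);
   (11909, 1)]);
  (920793289987614829, 1230855683509, Order 901045223395723423 1230855683509
   [:: (1230855683509, 1)]);
  (1217578865145459821, 42193, Order 896622516301315088 10162605980 [:: (2,
   2); (5, 1); (12043, 1); (42193, 1)]);
  (1424654839651318501, 1259, Order 1004491557102873276 96357689 [:: (8867,
   1); (10867, 1)]);
  (2215706511905910781, 97, Order 1998488375287791728 822672287 [:: (16417,
   1); (50111, 1)]);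
  (2793879899538857933, 75682086345727, Order 296081420096625048
   75682086345727 [:: (75682086345727, 1)]);
  (8728453840491298933, 2269049, Order 4522858472013211628 338088301 [::
   (149, 1); (2269049, 1)]);
  (18253746121007170937, 408237707, Order 149339630280016025 408237707 [::
   (408237707, 1)]);
  (18684340493097708613, 4339, Order 2834606715734219815 11154993361 [::
   (86117, 1); (129533, 1)]);
  (39761573197840285189, 347949588631, Order 16734631822575640011
   347949588631 [:: (347949588631, 1)]);
  (62404783042768303253, 56611769, Order 14275385170959387322 56611769 [::
   (56611769, 1)]);
  (179261096933449319293, 10136593, Order 132462106189553625572 91229337 [::
   (3, 2); (10136593, 1)]);
  (331538045386490422213, 103, Order 204019787128204009306 72298069 [:: (59,
   1); (103, 1); (11897, 1)]);
  (338423180957001923917, 1922336587, Order 159819922242270877789 1922336587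
   [:: (1922336587, 1)]);
  (357057122353408965641, 4285371127621327, Order 198236949962304362690
   4285371127621327 [:: (4285371127621327, 1)]);
  (382956365108124512569, 881, Order 135658285031480446113 120401132993 [::
   (188533, 1); (638621, 1)]);
  (640781113480489005961, 1804609, Order 254621900510080383806 6736605397 [::
   (3733, 1); (1804609, 1)]);
  (662682348938885191909, 2509615483867, Order 243113340287953991082
   2509615483867 [:: (2509615483867, 1)]);
  (824147144503988554097, 25884577, Order 120315237677908791751 414153232 [::
   (2, 4); (25884577, 1)]);
  (1034163155521863334433, 1207511, Order 890864602685533761987 156941412181
   [:: (129971, 1); (1207511, 1)]);
  (1780051652040095043377, 1905121, Order 373458016045406341966 12000357179
   [:: (6299, 1); (1905121, 1)]);
  (25786180109058058513753, 79559, Order 5060545763062615945599 190363126511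
   [:: (79559, 1); (2392729, 1)]);
  (66233674182432392484521, 38423089, Order 14830027598482480642456
   13001720125087 [:: (338383, 1); (38423089, 1)]);
  (129838657556525654982001, 2, Order 117116481140675563388215 14621440807499
   [:: (655223, 1); (22315213, 1)]);
  (465830397220551032500001, 12903563, Order 44410965673107518288692
   598867262393 [:: (46411, 1); (12903563, 1)]);
  (42496138760996089925358313, 17, Order 12588466425340227111060473
   1269473020411 [:: (823, 1); (12277, 1); (125641, 1)]);
  (392713696453430494773451841, 2, Order 302979449010411834781511172
   3819486915731 [:: (233, 1); (12269, 1); (1336103, 1)])]%num.

Definition exclusions : seq (N * N) := [::
  (7, 113); (11, 2113); (17, 17); (19, 525313); (25, 8101); (27, 246241);
  (29, 107367629); (37, 593); (39, 1249); (43, 500177); (45, 54001);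
  (47, 3761); (53, 15358129); (59, 157649); (71, 148587949); (73, 9929);
  (83, 13063537); (97, 97); (103, 103); (107, 23528569104401);
  (109, 74323515777853); (113, 113); (123, 6027043735173469); (127, 26417);
  (137, 137); (139, 1408349); (155, 37201); (157, 2790467761); (163, 163);
  (167, 75005713); (169, 180201997); (173, 13625405957); (183, 5080081);
  (191, 25212001); (193, 193); (257, 257); (269, 8609); (299, 20333);
  (331, 1780051652040095043377); (337, 337); (347, 5575597);
  (349, 27547678215997); (353, 353); (401, 401); (403, 25793); (359, 585889);
  (383, 111650629); (389, 389); (393, 12577); (397, 25409); (439, 695377);
  (443, 443); (445, 1153441); (449, 449); (461, 14753); (479, 479);
  (487, 487); (491, 1748832017); (529, 425654561); (537, 111697);
  (541, 1281089); (463, 46475941); (505, 32321); (509, 103837); (521, 16673);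
  (523, 8369); (673, 673); (691, 11057); (773, 773); (797, 1131019499249);
  (809, 25889); (811, 811); (823, 823); (827, 291599907662880149);
  (911, 29153); (919, 919); (929, 929); (937, 524704862656309);
  (947, 1440383213); (953, 953); (1123, 1123); (1129, 279811361); (769, 769);
  (839, 2793879899538857933); (853, 64007056091437); (859, 41233);
  (877, 178909); (881, 881); (887, 887); (895, 94622981); (905, 62984381);
  (1151, 36833); (1153, 1153); (1163, 37217); (1187, 1187); (1201, 1201);
  (1217, 1217); (1229, 1229); (1237, 1237); (1249, 1249); (1259, 1259);
  (1283, 1283); (1289, 2206769); (1297, 1297); (1307, 1307); (1327, 1327);
  (1361, 1361); (1367, 10955646370897); (1381, 17036017);
  (2003, 830680803436697); (2011, 920793289987614829); (2017, 2017);
  (2027, 261508343832349); (2039, 101884753); (2049, 5376577);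
  (2053, 45092093); (2063, 2063); (2069, 221157147961); (2081, 2081);
  (2099, 12937984121); (2111, 1842150665843953); (2113, 2113);
  (2127, 37690441); (2129, 2129); (2137, 1162529); (2141, 31463442317);
  (2143, 2143); (2153, 272492464241); (2161, 2161); (2199, 2992293649);
  (2207, 5998435712461); (2217, 390193); (2221, 35537); (2237, 393713);
  (2239, 52484608344350561); (2243, 71777); (2253, 127015129); (2267, 2267);
  (2269, 2269); (2273, 2273); (2287, 180361969); (2309, 2309);
  (2341, 1161137); (2347, 2347); (2351, 19936481); (2361, 36302737);
  (2371, 493169); (2381, 2381); (2383, 25479896548961); (2399, 115153);
  (2411, 2411); (2417, 2417); (2437, 127620817); (2459, 2459); (2463, 39409);
  (2467, 2467); (2473, 2473); (2477, 2477); (2487, 4496497); (3347, 3347);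
  (3351, 228528049218195313); (3359, 161233); (3361, 3361); (3371, 3371);
  (3373, 11141233576769); (3385, 46807781); (3391, 3391); (3407, 2071457);
  (3427, 54833); (3449, 6306332272417); (3457, 3457); (3461, 1772033);
  (3463, 3463); (3467, 3467); (3469, 3469); (3491, 1029356261);
  (3499, 38097113); (3511, 2651916413187229); (3513, 477769);
  (3517, 42539437393); (3527, 94453061); (3529, 846961); (3539, 2491457);
  (3541, 2889457); (3543, 340129); (3547, 18955169); (3559, 3559);
  (3571, 3571); (3581, 114593); (3583, 57329); (3593, 3593);
  (3595, 284378881); (3607, 865681); (3613, 824147144503988554097);
  (3617, 3617); (3623, 4289633); (3631, 16964033); (3635, 174481);
  (3637, 3319213489); (3639, 812836153); (3659, 468353); (3671, 117765004537);
  (3673, 3673); (3677, 3677); (3691, 4214531441); (3697, 3697);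
  (3701, 39793153); (3709, 3709); (3715, 25945561); (3727, 3727);
  (3739, 2034017); (3761, 3761); (3767, 1983807677); (3769, 12181409);
  (3779, 3779); (3793, 3793); (3803, 365089); (3805, 1567661);
  (3823, 66233674182432392484521); (3831, 61297); (3833, 3833); (3847, 3847);
  (3851, 544515997); (3853, 616481); (3863, 3863); (3873, 867553);
  (3877, 3877); (3881, 3881); (3889, 3889); (3907, 13161276481); (3911, 3911);
  (3919, 3919); (3947, 3947); (3963, 63409); (3967, 13487801); (4001, 4001);
  (4013, 4013); (4021, 62404783042768303253); (4027, 64433); (4049, 4049);
  (4051, 4051); (4057, 5517521); (4073, 391009); (4079, 2284241);
  (4091, 4091); (4111, 4111); (4119, 21418801); (4127, 4127); (4129, 4129);
  (4133, 7400704853629); (4139, 927137); (4153, 39761573197840285189);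
  (4159, 3703040513); (4163, 5328641); (10007, 4082857); (10009, 7486733);
  (10029, 286508473); (10037, 10037); (10039, 10039); (10061, 23864693);
  (10067, 2204431393); (10079, 2111953661); (10091, 10091); (10093, 5490593);
  (10099, 10099); (10103, 249304820549); (10111, 10111); (10117, 161873);
  (10133, 10133); (10139, 10139); (10145, 244210441); (10151, 55628387418193);
  (10159, 1137809); (10163, 3976061058737); (10167, 662682348938885191909);
  (10177, 10177); (10181, 8633489); (10193, 10193); (10201, 31940473797629);
  (10211, 10211); (10223, 4907041); (10231, 163697); (10239, 191206853953);
  (10243, 676544454893); (10247, 819761); (10259, 46616897);
  (10267, 60000349); (10271, 1813098135161); (10273, 10273); (10289, 10289);
  (10291, 5013569381); (10299, 31613686813); (10301, 10301); (10303, 10303);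
  (10313, 330017); (10321, 10321); (10333, 31125492783457); (10337, 10337);
  (10343, 145240175444293); (10349, 884922293); (10357, 165713);
  (10369, 10369); (10391, 45595709); (10399, 10399);
  (10415, 357057122353408965641); (10419, 4501009); (10427, 10427);
  (10429, 1501777); (10433, 10433); (10435, 22038721);
  (10445, 463426974911171041); (10453, 167249); (10457, 10457);
  (10459, 669377); (10477, 10477); (10499, 10976956477); (10501, 56453377);
  (10513, 10513); (10515, 1345921); (10529, 10529); (10531, 10531);
  (10567, 32123681); (10589, 272179657); (10597, 390435640334053);
  (10599, 493701421); (10601, 125713824277); (10607, 10607);
  (10613, 83757797); (10627, 12684209091481); (10631, 232597562581);
  (10639, 9192097); (10655, 20841181); (10657, 10657); (10663, 10663);
  (10671, 1451257); (10673, 57204846557); (10687, 10687);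
  (10691, 15848680513); (10709, 282224116408338869); (10711, 10711);
  (10723, 18684340493097708613); (10729, 465830397220551032500001);
  (10737, 171793); (10739, 5884973); (10741, 7217953); (10753, 10753);
  (10771, 18253746121007170937); (10777, 172433); (10781, 1343873213);
  (10783, 90523543793); (10789, 160022449); (10799, 1456914689);
  (10831, 126376109); (10837, 12527573); (10847, 10847); (10853, 10853);
  (10859, 347489); (10861, 14878831453); (10867, 1424654839651318501);
  (10883, 10883); (10889, 10889); (10891, 53752704757); (10895, 22050695561);
  (10903, 813058517); (10919, 1034163155521863334433);
  (10929, 4048080173520637); (10937, 17717941); (10939, 158443977800643593);
  (10949, 10949); (10957, 75253947274969); (10973, 494930932337);
  (10987, 10547521); (10993, 10993); (11003, 9340175422135301);
  (11007, 382956365108124512569); (11015, 4582241); (11041, 1393212736417);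
  (11047, 176753); (11057, 11057); (11059, 11059); (11065, 70019321);
  (11069, 1340181078869); (11071, 188771118598021); (11079, 595917253);
  (11083, 25180577); (11087, 11087); (11093, 887441); (11111, 4873284601);
  (11113, 3778421); (11119, 11119); (11141, 306823141); (11149, 11149);
  (11157, 261029173); (11159, 12391206418616453); (11161, 12902117);
  (11171, 286871281); (11173, 715073); (11177, 59156686733);
  (11199, 640781113480489005961); (11213, 225112189); (11219, 14497117305841);
  (11239, 11239); (11251, 11251); (11255, 144699558189821);
  (11257, 14501312429); (11261, 618176726615857); (11273, 11273);
  (11279, 11279); (11287, 2215706511905910781); (11299, 434544194059769);
  (11311, 468863573); (11317, 2692423124273); (11329, 11329); (11351, 11351);
  (11355, 223057621); (11357, 21597425189); (11369, 4638553);
  (11377, 120323153); (11383, 182129); (11391, 1714710013); (11393, 11393);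
  (11399, 5655412315681); (11405, 52978095421); (11411, 11411);
  (11423, 1799012656433); (11437, 11437); (11443, 11443); (11447, 11447);
  (11463, 1293760033); (11465, 779621); (11467, 179261096933449319293);
  (11471, 550609); (11477, 3856273); (11479, 10652513); (11483, 60079057);
  (11485, 183761); (11489, 11489); (11491, 765024817); (11497, 11497);
  (11503, 11503); (11511, 2909152009); (11519, 11519); (11521, 184337);
  (11527, 11527); (11549, 25786180109058058513753);
  (11551, 263717472998966521); (11555, 554641); (11563, 7770337);
  (11569, 10180721); (11579, 139045402549); (11587, 11587);
  (11593, 48308911265022449); (11603, 39914321); (11617, 11617);
  (11621, 490768775201); (11633, 11633); (11657, 614642118801013);
  (11659, 8728453840491298933); (11665, 3919441); (11677, 844293809);
  (11681, 11681); (11689, 11689); (11695, 1590521); (11699, 11699);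
  (11709, 6245346421); (11717, 4912537097393); (11719, 7593913);
  (11727, 562897); (11731, 11731); (11743, 11743); (11749, 2306845657);
  (11751, 18912482437); (11769, 2393866477753); (11771, 52029326689);
  (11777, 11777); (11779, 2261569); (11783, 11783); (11785, 11785001);
  (11787, 116219821); (11791, 5805133777); (11793, 729297469909);
  (11801, 974668193); (11807, 11807); (11813, 22113937);
  (11821, 14068894694089); (11827, 11827); (11829, 349949137);
  (11831, 2271553); (11833, 11833); (11839, 11839); (11863, 10155866849);
  (11867, 11867); (11871, 217829953477); (11885, 49535645924372161);
  (11887, 760769); (11897, 331538045386490422213); (11903, 6338490337);
  (11909, 876970426585550701); (11923, 4196897); (11927, 28182529378873);
  (11929, 1690482449); (11933, 3502383233); (11941, 37160393);
  (11945, 382241); (11953, 11953); (11959, 194168203811293); (11965, 191441);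
  (11967, 85762271389); (11969, 11969); (11981, 91438993);
  (11987, 15363977641); (11993, 35067533); (12007, 505238158438001);
  (12009, 9167549549281); (12011, 12011); (12013, 1257703940416129);
  (12017, 34320553); (12021, 162283501); (12037, 12037);
  (12043, 1217578865145459821); (12049, 12049); (12057, 10029687793);
  (12071, 12071); (12073, 1181029153); (12097, 12097); (12101, 122074889);
  (12107, 12107); (12109, 12109); (12113, 12113); (12115, 581521);
  (12119, 1369926123307673); (12127, 2649603977); (12139, 3858429268997);
  (12143, 385779418529); (12157, 585432248861); (12161, 12161);
  (12163, 194609); (12197, 501979733); (12203, 47246087122121);
  (12205, 195281); (12211, 199478897); (12227, 12227); (12233, 3745206349);
  (12235, 39935041); (12239, 670697201); (12241, 12241); (12251, 980081);
  (12253, 12253); (12263, 12263); (12269, 392713696453430494773451841);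
  (12277, 42496138760996089925358313); (12279, 392929); (12281, 12281);
  (12289, 12289); (12297, 94637713); (12301, 338423180957001923917);
  (12323, 23610869); (12329, 394529); (12343, 12343); (12347, 12347);
  (12373, 12373); (12377, 12377); (12379, 12379); (12391, 40500429577);
  (12401, 12401); (12409, 923747384684497); (12413, 941203313);
  (12421, 13995138173); (12433, 12433); (12437, 129838657556525654982001);
  (12451, 12152177); (12471, 2139125689); (12473, 855540009786755257);
  (12479, 12479); (12487, 12487); (12491, 12491); (12497, 12497)]%num.

Definition of_chunks (ds : seq N) : N :=
  foldl (fun x d => x * 10 ^ 70 + d)%num 0%num ds.

(** Obtained from two square roots modulo the Aurifeuillian factor, which is a
    prime. *)
Definition quartic_root_457 : N := of_chunks [::
  345005099871638648589028520965619897042210706957409894633692310084;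
  6406286284235294980811303220349421251231776070306119314810974603036424]%num.

Definition quartic_root_10141 : N := of_chunks [::
  1413603360547283112840062693173002698182497;
  0582467119405162601137987944936808219449878067245981786694315884228877;
  1388862143079293270020937651856244366493565349200396211157555570123598;
  7433041423053130156783378228527365390857240601991628290032742340376770;
  0156793257684005927971202179996847727693173922435798047278471042894734;
  2810951434335403669503485275808670987456394747111012873872990479839206;
  7959446507320881615661580548608305188081020747072156665202556944003582;
  3262759992896420153829598510006696243892922898508694113335030632550618;
  8618069805252352795896692984880243758973352808046347317269721452607840;
  8427551329522016875684248340096764073981732848373425142440233009722228;
  7343199437467542094180204117404860438905378091552480411836712940995943;
  8485459825558570462056881961490176753762197752188823372752113207528667;
  9977897825650790645858106853764465811490499252542401315194646129304277;
  2962634383257753707456218953854415696153983057528130165985167042245121;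
  9886085529485381096162475642350296505073840642821540047593525289361626;
  7212811961766925366940997912907280118210119704153767343011615855276247;
  2354178367632708973497053936886625277106937990749249856994257709368660;
  8087823704672725402081826544764510056045610287946528597606956718012093;
  5081060157835371277005615732712749165349382909007783926378924563561332;
  0383776068302277222692228836125416139844126289665661698365859629319196;
  5870899774877731516688886946274671138403287318131800641659930397542097;
  3005388612089661337218036631548561057704813705510165834954422953998164;
  8418757692217971755305170237557331471499568886620607490612863362254150;
  2946331926921240131282776575446463993277654114376720276835695724043124;
  0251114613817641882120020040606410888895923335079786975964711347341065;
  3780857690947207967733091014589109458782039219873385553619076785546822;
  0569711106242707157081028506710040050221934216800737119765053932588234;
  5865519582168732143003012493477925610344686445806801837860914210773308;
  4411473140960085253868393128609572879647296908945817221596955980161752;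
  8111273575652035775860011147046220575454103276053225999581608253135339;
  0421487773500947526726697348630670747354638874701669691271442714956495;
  2508005480357621132797993823633382804275922277733888593622001864777785;
  2814857977594752637378260457762322581567273853551782365894430574087363;
  0361469107757952730006478183556827569660265226321210786383235425063190;
  8950505060390005943042705102361041393468528875958507474980798328560805;
  7306040861997437882112457814893424954623535449866070877527088808991301;
  4650698451423356701626555061121486053114109205048966082194229968615821;
  1434472307988880285089407284738504090120329070192184290541312970578983;
  1109682941318483575814813885541063647560789851539187122747098841736100;
  7717338714095748869767253881119553880337959858154986352646659764266196;
  0352201392298611565677800164344927464965740537657275670265062335804985;
  6754949620158464959506049445800443176314458695150745645019975923048361;
  1264029143408981872094927245962742687478850526006880225710245832564964;
  5226144549277364472584894682815149833559204861665199329673131022517749]%num.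

(** * The interval *)

Lemma non_higgs_primes_ok : non_higgs_check [::] non_higgs_primes.
Proof. by vm_compute. Qed.

Lemma exclusions_ok :
  all (exclusion_check [seq e.1.1 | e : entry <- non_higgs_primes]) exclusions.
Proof. by vm_compute. Qed.

Lemma quartic_root_457_ok : quartic_check 457 false quartic_root_457.
Proof. by vm_compute. Qed.

Lemma quartic_root_10141_ok : quartic_check 10141 true quartic_root_10141.
Proof. by vm_compute. Qed.

Definition excluded_divisors : seq N :=
  [:: 457%num, 10141%num & map fst exclusions].

Lemma excluded_divisorsP d : d \in excluded_divisors -> excluded d.
Proof.
rewrite /excluded_divisors 2!in_cons => /or3P[/eqP->|/eqP->|/mapP[dp dp_in ->]].
- exact: quartic_checkP quartic_root_457_ok.
- exact: quartic_checkP quartic_root_10141_ok.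
apply: exclusion_checkP (allP exclusions_ok _ dp_in) _.
exact: non_higgs_checkP non_higgs_primes_ok _.
Qed.

Lemma cover_ok :
  covered (map bin_of_nat candidates) excluded_divisors 1250 10001%num.
Proof. by vm_compute. Qed.

Theorem theorem15 (m : nat) :
  Heven m -> 20000 < m <= 25000 -> m \in candidates.
Proof.
case=> Hm m_even m_range; have [/not_H_dvd4//|m4] := boolP (4 %| m).
(* Linear arithmetic understands these products, but not the large literals. *)
have {}m_range : 20 * 1000 < m <= 25 * 1000 by apply: m_range.
have def_m : m = 2 * m./2.
  by rewrite -[LHS]odd_double_half (negPf m_even) add0n mul2n.
have k_odd : odd m./2.
  by apply: contraNT m4 => k_even; rewrite def_m (@dvdn_mul 2 2) // dvdn2.
have i_lt : (m./2 - 10001%num)./2 < 1250 by lia.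
have [k def_k k_cov] := coveredP cover_ok i_lt.
have {i_lt} def_k2 : m./2 = k by lia.
rewrite {}def_k2 in def_m k_odd.
case: k_cov => [/mapP[m' m'_in def_m']|[d d_ds d_k]].
  suff -> : m = m' by [].
  by rewrite def_m -[m']bin_of_natK -def_m' nat_of_mul.
have /dvdnP[c def_c] : d %| k by rewrite -dvdNE.
case: (@excluded_not_H d c _ (excluded_divisorsP d_ds)).
  by move: k_odd; rewrite def_c oddM => /andP[].
by rewrite (mulnC d) -def_c -def_m.
Qed.
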